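(* Let $\mathbf X$ be a finite dimensional Hilbert space and assume that $f:\mathbf X\to[-\infty,\infty]$ is prox-regular and subdifferentially continuous at $\bar x$ for $\bar v\in\partial f(\bar x)$. Then the following properties are equivalent: (a) $\partial f$ is strictly proto-differentiable at $\bar x$ for $\bar v$; (b) $D(\partial f)(x,v)$ graph-converges to $D(\partial f)(\bar x,\bar v)$ as $(x,v)\to(\bar x,\bar v)$ with $(x,v)\in\mathrm{gph}\,\partial f$; (c) $D(\partial f)(x,v)$ graph-converges to $D(\partial f)(\bar x,\bar v)$ as $(x,v)\to(\bar x,\bar v)$ in the set of pairs $(x,v)\in\mathrm{gph}\,\partial f$ such that $\partial f$ is proto-differentiable at $x$ for $v$; (d) $D(\partial f)(x,v)$ graph-converges to $D(\partial f)(\bar x,\bar v)$ as $(x,v)\to(\bar x,\bar v)$ in the set of pairs $(x,v)\in\mathrm{gph}\,\partial f$ such that $\partial f$ is proto-differentiable at $x$ for $v$ and $T_{\mathrm{gph}\,\partial f}(x,v)$ is a linear subspace.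
   Context: Set limits are in the Painlevé–Kuratowski sense. For a set $\Omega$ and $x\in\Omega$: $T_\Omega(x)=\limsup_{t\searrow0}\frac{\Omega-x}{t}$ (tangent cone), $\check T_\Omega(x)=\liminf_{t\searrow0}\frac{\Omega-x}{t}$ (derivable cone), $\widehat T_\Omega(x)=\liminf_{x'\to x,\,x'\in\Omega,\,t\searrow0}\frac{\Omega-x'}{t}$ (regular tangent cone), $\widetilde T_\Omega(x)=\limsup_{x'\to x,\,x'\in\Omega,\,t\searrow0}\frac{\Omega-x'}{t}$ (paratingent cone). The regular normal cone is the polar $\widehat N_\Omega(x)=T_\Omega(x)^*$; the limiting normal cone $N_\Omega(\bar x)$ consists of limits of $v^k\in\widehat N_\Omega(x^k)$ with $x^k\to\bar x$, $x^k\in\Omega$. For $f:\mathbf X\to[-\infty,\infty]$ with $f(\bar x)$ finite, $\partial f(\bar x)=\{v\mid(v,-1)\in N_{\mathrm{epi}f}(\bar x,f(\bar x))\}$. $f$ is prox-regular at $\bar x$ for $\bar v$ if $f$ is finite at $\bar x$, locally lower semicontinuous around $\bar x$, $\bar v\in\partial f(\bar x)$, and there exist $\varepsilon>0$, $r\ge0$ such that $f(x')\ge f(x)+\langle v,x'-x\rangle-\frac r2\|x'-x\|^2$ for all $x'$ with $\|x'-\bar x\|\le\varepsilon$ whenever $v\in\partial f(x)$, $\|(x,v)-(\bar x,\bar v)\|\le\varepsilon$ and $f(x)<f(\bar x)+\varepsilon$. $f$ is subdifferentially continuous at $\bar x$ for $\bar v$ if $(x^k,v^k)\to(\bar x,\bar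 v)$ with $v^k\in\partial f(x^k)$ implies $f(x^k)\to f(\bar x)$. For a set-valued mapping $F$ and $(x,y)\in\mathrm{gph}\,F$: the graphical derivative $DF(x,y)$ is the set-valued mapping with $\mathrm{gph}\,DF(x,y)=T_{\mathrm{gph}F}(x,y)$; $F$ is proto-differentiable at $x$ for $y$ if $\check T_{\mathrm{gph}F}(x,y)=T_{\mathrm{gph}F}(x,y)$; $F$ is strictly proto-differentiable at $x$ for $y$ if $\widehat T_{\mathrm{gph}F}(x,y)=\widetilde T_{\mathrm{gph}F}(x,y)$. Set-valued mappings graph-converge if their graphs converge as sets. *)

(* Defs.v *)
From HB Require Import structures.
From mathcomp Require Import all_boot all_order all_algebra.
From mathcomp Require Import all_classical all_reals all_analysis.

Set Implicit Arguments.
Unset Strict Implicit.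
Unset Printing Implicit Defensive.

Import Order.TTheory GRing.Theory Num.Theory.
Import numFieldNormedType.Exports.

Local Open Scope classical_set_scope.
Local Open Scope ring_scope.

(* Painleve-Kuratowski limits of S t as t runs along the filter F. In the
   metrizable spaces used below this agrees with the sequential formulation:
   y is in the outer (inner) limit iff every neighbourhood of y meets S t
   frequently (eventually). *)
Definition pk_limsup (T : Type) (Y : topologicalType) (F : set_system T)
    (S : T -> set Y) : set Y :=
  [set y | forall (A : set T) (U : set Y), F A -> nbhs y U ->
     exists2 t, A t & S t `&` U !=set0].

Definition pk_liminf (T : Type) (Y : topologicalType) (F : set_system T)
    (S : T -> set Y) : set Y :=
  [set y | forall U : set Y, nbhs y U -> \forall t \near F, S t `&` U !=set0].

Definition pk_converges (T : Type) (Y : topologicalType) (F : set_system T)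
    (S : T -> set Y) (C : set Y) : Prop :=
  pk_limsup F S = C /\ pk_liminf F S = C.

Section Cones.
Variables (R : realType) (V : normedModType R).
Implicit Types (Omega : set V) (x : V).

Definition diff_quotient Omega x (t : R) : set V :=
  [set t^-1 *: (y - x) | y in Omega].

Definition tangent_cone Omega x : set V :=
  pk_limsup 0^'+ (diff_quotient Omega x).

Definition derivable_cone Omega x : set V :=
  pk_liminf 0^'+ (diff_quotient Omega x).

Definition regular_tangent_cone Omega x : set V :=
  pk_liminf (filter_prod (within Omega (nbhs x)) 0^'+)
    (fun p : V * R => diff_quotient Omega p.1 p.2).

Definition paratingent_cone Omega x : set V :=
  pk_limsup (filter_prod (within Omega (nbhs x)) 0^'+)
    (fun p : V * R => diff_quotient Omega p.1 p.2).

Definition polar_cone (inner : V -> V -> R) (K : set V) : set V :=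
  [set v | forall w, K w -> inner v w <= 0].

Definition regular_normal_cone (inner : V -> V -> R) Omega x : set V :=
  polar_cone inner (tangent_cone Omega x).

Definition limiting_normal_cone (inner : V -> V -> R) Omega x : set V :=
  [set v | exists (xs vs : nat -> V),
     [/\ forall k, Omega (xs k) /\ regular_normal_cone inner Omega (xs k) (vs k),
         xs k @[k --> \oo] --> x
       & vs k @[k --> \oo] --> v]].

Definition linear_subspace (L : set V) : Prop :=
  L 0 /\ forall (a : R) (u v : V), L u -> L v -> L (a *: u + v).

End Cones.

Section SetValuedMappings.
Variables (R : realType) (X Y : normedModType R).
Implicit Types F : X -> set Y.

Definition gph F : set (X * Y) := [set p | F p.1 p.2].

Definition graphical_derivative F (x : X) (y : Y) : X -> set Y :=
  fun w => [set z | tangent_cone (gph F) (x, y) (w, z)].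

Definition proto_differentiable F (x : X) (y : Y) : Prop :=
  derivable_cone (gph F) (x, y) = tangent_cone (gph F) (x, y).

Definition strictly_proto_differentiable F (x : X) (y : Y) : Prop :=
  regular_tangent_cone (gph F) (x, y) = paratingent_cone (gph F) (x, y).

Definition graph_converges (T : Type) (Phi : set_system T)
    (S : T -> X -> set Y) (G : X -> set Y) : Prop :=
  pk_converges Phi (fun t => gph (S t)) (gph G).

End SetValuedMappings.

Definition finite_dimensional (R : realType) (X : lmodType R) : Prop :=
  exists (n : nat) (e : 'I_n -> X), forall x : X,
    exists c : 'I_n -> R, x = \sum_(i < n) c i *: e i.

Section Functions.
Variables (R : realType) (X : normedModType R) (inner : X -> X -> R).
Implicit Types f : X -> \bar R.

Definition epi f : set (X * R) := [set p | (f p.1 <= p.2%:E)%E].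

Definition epi_inner (p q : X * R) : R := inner p.1 q.1 + p.2 * q.2.

(* Empty at the points where f is not finite. *)
Definition subdifferential f (x : X) : set X :=
  [set v | f x \is a fin_num /\
     limiting_normal_cone epi_inner (epi f) (x, fine (f x)) (v, -1)].

(* Rockafellar and Wets, Variational Analysis, Definition 1.33; it holds as
   soon as f is lower semicontinuous on a neighbourhood of xbar. *)
Definition locally_lsc f (xbar : X) : Prop :=
  exists2 eps : R, 0 < eps & forall alpha : R,
    (alpha%:E <= f xbar + eps%:E)%E ->
    closed [set x | `|x - xbar| <= eps /\ (f x <= alpha%:E)%E].

(* The norm on X * X that comes with the library is the max norm, hence the
   explicit Euclidean product norm. *)
Definition prox_regular f (xbar vbar : X) : Prop :=
  [/\ f xbar \is a fin_num,
      locally_lsc f xbar,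
      subdifferential f xbar vbar
    & exists eps r : R, [/\ 0 < eps, 0 <= r
      & forall x v : X, subdifferential f x v ->
          Num.sqrt (`|x - xbar| ^+ 2 + `|v - vbar| ^+ 2) <= eps ->
          (f x < f xbar + eps%:E)%E ->
          forall x' : X, `|x' - xbar| <= eps ->
          (f x + (inner v (x' - x) - r / 2 * `|x' - x| ^+ 2)%:E <= f x')%E]].

Definition subdifferentially_continuous f (xbar vbar : X) : Prop :=
  forall xs vs : nat -> X,
    (forall k, subdifferential f (xs k) (vs k)) ->
    xs k @[k --> \oo] --> xbar ->
    vs k @[k --> \oo] --> vbar ->
    f (xs k) @[k --> \oo] --> f xbar.

End Functions.

(* Main.v *)
Require Import Defs.
From HB Require Import structures.
From mathcomp Require Import all_boot all_order all_algebra.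
From mathcomp Require Import all_classical all_reals all_analysis.
From mathcomp Require Import measurable_realfun unstable ring lra.
Set Implicit Arguments.
Unset Strict Implicit.
Unset Printing Implicit Defensive.
Import Order.TTheory GRing.Theory Num.Theory.
Import numFieldNormedType.Exports.
Local Open Scope classical_set_scope.
Local Open Scope ring_scope.

(* By prox-regularity and subdifferential continuity, near (xbar, vbar) the graph
   of the subdifferential is {(P u, (u - P u) / lam)} for a Lipschitz mapping P,
   the proximal mapping of f with a small parameter lam: hypomonotonicity makes
   u = x + lam v determine (x, v), and minimizing f + |. - u|^2 / (2 lam) over a
   small ball produces a pair (x, v) for every u near xbar + lam vbar. In the
   coordinate u, (a) says that P is strictly differentiable at xbar + lam vbar,
   which yields the convergence of the tangent cones along any subset of the
   graph accumulating at (xbar, vbar). The points of (d) contain the images of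
   the Gateaux differentiability points of P. By Rademacher's theorem, these are
   dense, so that the filters in (c) and (d) are proper, and they exhaust almost
   every line of a given direction up to a small translation; integrating along
   such lines turns the convergence of derivatives in (d) into strict
   differentiability.

   Rademacher's theorem is proved for the ideal of Aronszajn null sets, that is
   finite unions of Borel sets that are null on every line parallel to one of the
   basis vectors: points of non-differentiability along a basis vector are null by
   definition of this ideal and the one-dimensional theorem, and Fubini's theorem
   is only needed to see that the ideal is proper. *)

(** * Lipschitz functions of one real variable *)

(** In the coordinate u = x + lam v, a tangent vector (y, z) of the graph becomes a direction w = y
    + lam z together with a cluster value y of the difference quotients of P along w. Every
    statement about cones is read as a statement about these values, so that (a) and the convergence
    in (b), (c), (d) concern the same quantities.

    The obstacle is that (d) gives information at points of differentiability only, whereas (a)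
    compares increments between arbitrary points near the base point, and the segment joining two
    given points may consist of exceptional points. It has to be replaced by a parallel segment,
    which changes the increment by at most the Lipschitz constant times the shift. The null sets
    must therefore be stable under passing to the set of bad lines in an arbitrary direction w, not
    only in the basis directions. An ideal defined by lines has this property by Fubini's theorem in
    planes, and it requires no measure on the space.

    P is first obtained on a ball only; it is extended to the whole space, with a larger Lipschitz
    constant, so that complete lines are available. *)

Section StieltjesOfMonotoneLipschitz.
Variables (R : realType) (G H : R -> R).
Hypothesis G_nd : {homo G : x y / x <= y}.
Hypothesis H_nd : {homo H : x y / x <= y}.
Hypothesis GH : forall x, G x + H x = x.
Local Notation mu := (@lebesgue_measure R).

(** As F' = id - F is nondecreasing too, F grows no faster than the identity. Right continuity is
    what a Stieltjes measure asks of F. *)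
Let lip (F F' : R -> R) : {homo F' : x y / x <= y} ->
  (forall x, F x + F' x = x) -> {homo F : x y / x <= y} -> right_continuous F.
Proof.
move=> nd E Fnd x; apply/cvgrPdist_le => e e0; near=> y.
have xy : x <= y by near: y; apply: nbhs_right_ge.
rewrite distrC ger0_norm ?subr_ge0 ?Fnd//.
have yx : y <= x + e by near: y; apply: nbhs_right_le; rewrite ltrDl.
have := nd _ _ xy; have := E x; have := E y.
lra.
Unshelve. all: by end_near. Qed.

HB.instance Definition _ := isCumulative.Build R _ R G G_nd (lip H_nd GH G_nd).
Let HG x : H x + G x = x. Proof. by rewrite addrC GH. Qed.
HB.instance Definition _ := isCumulative.Build R _ R H H_nd (lip G_nd HG H_nd).

Let nuG : {measure set (measurableTypeR R) -> \bar R} := lebesgue_stieltjes_measure G.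
Let nuH : {measure set (measurableTypeR R) -> \bar R} := lebesgue_stieltjes_measure H.

Let lsE (F : cumulative R R) a b : a <= b ->
  lebesgue_stieltjes_measure F `]a, b] = (F b - F a)%:E.
Proof.
move=> ab; rewrite /lebesgue_stieltjes_measure /measure_extension/=.
rewrite measurable_mu_extE/=; last exact: is_ocitv.
by rewrite wlength_itv_bnd// EFinB.
Qed.

(* The Stieltjes measures of G and H add up to that of the identity, which is
   Lebesgue measure; hence each of them is dominated by it. *)
Lemma monotone_lipschitz_measure : exists nu : {measure set (measurableTypeR R) -> \bar R},
  (forall a b, a <= b -> nu `]a, b]%classic = (G b - G a)%:E) /\ nu `<< mu.
Proof.
exists nuG; split; first by move=> a b ab; exact: lsE.
apply/null_content_dominatesP => A mA A0.
have muE : mu A = measure_add nuG nuH A.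
  apply: lebesgue_measure_unique => // _ [[a b] _ <-] /=.
  have [ab|ba] := leP a b; last first.
    by rewrite set_itv_ge ?measure0// -leNgt bnd_simp ltW.
  rewrite [LHS](lsE _ ab) [RHS]measure_addE.
  rewrite [X in (_ = X + _)%E](lsE _ ab) [X in (_ = _ + X)%E](lsE _ ab) -EFinD.
  by congr EFin; have := GH a; have := GH b; rewrite /=; lra.
apply/eqP; rewrite eq_le measure_ge0 andbT -A0 [leRHS]muE.
by rewrite [leRHS]measure_addE leeDl.
Qed.

End StieltjesOfMonotoneLipschitz.

(** * Fundamental theorem of calculus and mean value inequality *)

Section OneDim.
Variable R : realType.
Local Notation mu := (@lebesgue_measure R).

(** The Stieltjes measure of G restricted to ]a, b] is finite, so its Radon-Nikodym density is
    integrable on the whole line. By Lebesgue differentiation the primitive of the density is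
    differentiable almost everywhere with that derivative, and inside ]a, b[ the primitive is G - G
    a. *)
Lemma monotone_lipschitz_integral (G H : R -> R) (a b : R) :
  {homo G : x y / x <= y} -> {homo H : x y / x <= y} ->
  (forall x, G x + H x = x) -> a < b ->
  exists f : R -> R, [/\ mu.-integrable setT (EFin \o f),
    {ae mu, forall x, a < x < b -> is_derive x 1 G (f x)} &
    (G b - G a)%:E = (\int[mu]_(x in `]a, b]) (f x)%:E)%E].
Proof.
move=> Gnd Hnd GH ab.
have [nu [nuE numu]] := monotone_lipschitz_measure Gnd Hnd GH.
have mI : measurable (`]a, b]%classic : set (measurableTypeR R)) by [].
have nuoo : (nu `]a, b]%classic < +oo)%E by rewrite nuE ?ltry// ltW.
pose nur : {finite_measure set (measurableTypeR R) -> \bar R} := mfrestr mI nuoo.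
have numur : nur `<< mu.
  apply/null_content_dominatesP => A mA A0.
  move/null_content_dominatesP : numu; apply; first exact: measurableI.
  by apply/eqP; rewrite eq_le measure_ge0 andbT -A0 le_measure ?inE//; exact: measurableI.
have [F [F0 Ffin Fint FE]] := radon_nikodym_sigma_finite numur.
have EF : EFin \o (fine \o F) = F by apply/funext => x /=; rewrite fineK.
have Gint x : a <= x -> x <= b -> (G x - G a)%:E = nu (`]-oo, x]%classic `&` `]a, b]%classic).
  move=> ax xb; rewrite -nuE//; congr (nu _); apply/seteqP; split => y /=; rewrite !in_itv/=.
    by move=> /andP[-> yx]; rewrite yx (le_trans yx).
  by move=> [-> /andP[->]].
exists (fine \o F); split.
- by rewrite EF.
- have /FTC1Ny : locally_integrable [set: R] (fine \o F).
    by apply: open_integrable_locally; rewrite ?EF//; exact: openT.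
  have intF y : mu.-integrable [set` `]-oo, y]] (EFin \o (fine \o F)).
    by rewrite EF; apply: integrableS Fint.
  move=> /(_ intF).
  apply: filterS; first exact: (ae_filter_ringOfSetsType mu).
  move=> x + /andP[ax xb].
  set P := (fun x => _ : R) => -[dP <-].
  have PG : {near x, (fun y => P y + G a) =1 G}.
    near=> y; rewrite /P /Rintegral.
    rewrite (_ : (\int[_]_(x in _) _)%E = nur `]-oo, y]%classic); last first.
      by rewrite FE//; apply: eq_integral => z _; rewrite fineK.
    rewrite /nur/= /mfrestr /mrestr/= -Gint/= ?subrK//.
      by near: y; apply: (@cvgr_ge R R (nbhs x) _ id x) => //; exact: cvg_id.
    by near: y; apply: (@cvgr_le R R (nbhs x) _ id x) => //; exact: cvg_id.
  have dPG : is_derive x 1 (fun y => P y + G a) ('D_1 P x).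
    rewrite -[X in is_derive _ _ _ X]addr0.
    apply: is_deriveD; exact: derivableP.
  have oneN0 : (1 : R) != 0 by exact: oner_neq0.
  have dG : is_derive x 1 G ('D_1 P x) by exact: near_eq_is_derive dPG.
  by rewrite derive1E.
- rewrite [LHS](_ : _ = nur `]a, b]%classic); last first.
    by rewrite /nur/= /mfrestr /mrestr/= setIid nuE// ltW.
  by rewrite FE//; apply: eq_integral => z _; rewrite /= fineK.
Unshelve. all: by end_near. Qed.

(** The derivative as an inequality without quotient: t = 0 is no exception, and [dirslope] and
    [vecslope] have the same form. *)
Definition slope (g : R -> R) (x d : R) := forall e, 0 < e ->
  exists2 del, 0 < del & forall t, `|t| < del ->
    `|g (x + t) - g x - d * t| <= e * `|t|.

Lemma is_derive_slope (g : R -> R) (x d : R) : is_derive x 1 g d -> slope g x d.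
Proof.
move=> [dg <-] e e0; have gd : h^-1 *: ((g \o shift x) (h *: 1) - g x) @[h --> 0^'] --> 'D_1 g x := dg.
move/cvgrPdist_le : gd => /(_ _ e0) /=.
rewrite near_withinE => -[del /= del0 D]; exists del => // t td.
have [->|t0] := eqVneq t 0; first by rewrite addr0 mulr0 subr0 subrr normr0 mulr0.
have := D t; rewrite /ball_/= sub0r normrN => /(_ td t0).
rewrite -[t *: 1]/(t * 1) mulr1 (addrC t) -[_ *: _]/(t^-1 * _).
rewrite -(ler_pM2r (_ : 0 < `|t|)) ?normr_gt0// -normrM mulrBl mulrAC mulVf// mul1r.
by rewrite distrC.
Qed.

Lemma slope_unique g x d d' : slope g x d -> slope g x d' -> d = d'.
Proof.
move=> gd gd'; apply/eqP; rewrite -subr_eq0 -normr_le0; apply/ler_addgt0Pr => e e0.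
have e20 : 0 < e / 2 by rewrite divr_gt0.
have [r r0 D] := gd _ e20; have [s s0 D'] := gd' _ e20.
pose t := Num.min r s / 2.
have t0 : 0 < t by rewrite divr_gt0// lt_min r0.
have tm : t < Num.min r s by rewrite /t ltr_pdivrMr// ltr_pMr ?lt_min ?r0// ltr1n.
move: tm; rewrite lt_min => /andP[tr ts].
have := D t; have := D' t; rewrite (gtr0_norm t0) => /(_ ts) + /(_ tr).
rewrite add0r => A B; rewrite -(ler_pM2r t0) -[X in _ * X](gtr0_norm t0) -normrM.
by move: A B; rewrite !ler_norml => /andP[? ?] /andP[? ?]; apply/andP; split; lra.
Qed.

Section Lipschitz.
Variables (g : R -> R) (L : R).
Hypothesis gL : forall x y, `|g x - g y| <= L * `|x - y|.

Let integrable_cst_oc a b (c : R) : mu.-integrable `]a, b] (EFin \o cst c).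
Proof.
apply: measurable_bounded_integrable => //.
- by rewrite [X in (X < _)%E]lebesgue_measure_itv/=; case: ifP => _; rewrite ?ltry// -EFinB ltry.
- by exists `|c|; split => // M cM x _; exact: ltW.
Qed.

Let integral_cst_oc a b (c : R) : a < b ->
  (\int[mu]_(x in `]a, b]) c%:E)%E = (c * (b - a))%:E.
Proof.
move=> ab; rewrite integral_cst//= [X in (_ * X)%E]lebesgue_measure_itv/= lte_fin ab.
by rewrite -EFinB -EFinM.
Qed.

(** With K above the Lipschitz constant, (x + g x / K) / 2 and (x - g x / K) / 2 are nondecreasing
    with sum x; the monotone case applies to the first one, and g is recovered from it. K = |L| + 1
    is positive whatever the sign of L. *)
Lemma lipschitz_integral a b : a < b -> exists f : R -> R,
  [/\ mu.-integrable `]a, b] (EFin \o f),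
    {ae mu, forall x, a < x < b -> slope g x (f x)} &
    (g b - g a)%:E = (\int[mu]_(x in `]a, b]) (f x)%:E)%E].
Proof.
move=> ab; pose K : R := `|L| + 1; have K0 : 0 < K by rewrite ltr_pwDr.
have gK x y : x <= y -> - (y - x) <= (g y - g x) / K <= y - x.
  move=> xy; rewrite ler_pdivlMr// ler_pdivrMr// mulNr -ler_norml.
  rewrite (le_trans (gL _ _))// ger0_norm ?subr_ge0// mulrC ler_wpM2l ?subr_ge0//.
  by rewrite /K (le_trans (ler_norm _))// lerDl.
pose G x := (x + g x / K) / 2; pose H x := (x - g x / K) / 2.
have Gnd : {homo G : x y / x <= y}.
  by move=> x y /gK; rewrite /G => /andP[? ?]; lra.
have Hnd : {homo H : x y / x <= y}.
  by move=> x y /gK; rewrite /H => /andP[? ?]; lra.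
have GH x : G x + H x = x by rewrite /G /H; lra.
have [f [fint fder fE]] := monotone_lipschitz_integral Gnd Hnd GH ab.
have gE x : g x = K * 2 * G x - K * x by rewrite /G; field; rewrite gt_eqF.
have fint' : mu.-integrable `]a, b] (EFin \o f) by exact: integrableS fint.
have EE : EFin \o (fun x => K * 2 * f x - K) =
   ((fun x => (K * 2)%:E * (EFin \o f) x) \- (EFin \o cst K))%E.
  by apply/funext => x /=; rewrite -EFinM EFinB.
have int1 : mu.-integrable `]a, b] (fun x => (K * 2)%:E * (EFin \o f) x)%E by exact: integrableZl.
exists (fun x => K * 2 * f x - K); split.
- rewrite EE; apply: integrableB => //; exact: integrable_cst_oc.
- apply: filterS fder; first exact: (ae_filter_ringOfSetsType mu).
  move=> x + xab => /(_ xab)/is_derive_slope fx e e0.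
  have eK : 0 < e / (K * 2) by rewrite divr_gt0// mulr_gt0.
  have [del del0 D] := fx _ eK; exists del => // t /D.
  rewrite mulrAC ler_pdivlMr ?mulr_gt0//.
  have K2 : 0 < K * 2 by rewrite mulr_gt0.
  move=> h; rewrite -(gtr0_norm K2) -normrM in h; apply: le_trans h.
  by rewrite !gE le_eqVlt; apply/orP; left; apply/eqP; congr `|_|; ring.
- rewrite [RHS](_ : _ = (\int[mu]_(x in `]a, b]) (EFin \o (fun x => K * 2 * f x - K)%R) x)%E)//.
  rewrite EE (integralB _ int1 (integrable_cst_oc a b K))//=.
  rewrite integralZl// -fE integral_cst_oc// -!EFinM -EFinB.
  by congr EFin; rewrite !gE; ring.
Qed.

Lemma lipschitz_ae_slope : {ae mu, forall x, exists d, slope g x d}.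
Proof.
have : {ae mu, forall x, forall n : nat, - n%:R < x < n%:R -> exists d, slope g x d}.
  apply/ae_foralln => n.
  case: n => [|n]; first by apply: aeW => x; rewrite oppr0 => /andP[/lt_trans h /h]; rewrite ltxx.
  have [|f [_ + _]] := @lipschitz_integral (- n.+1%:R) n.+1%:R.
    by rewrite -subr_gt0 opprK.
  apply: filterS; first exact: (ae_filter_ringOfSetsType mu).
  by move=> x fx xn; exists (f x); exact: fx.
apply: filterS; first exact: (ae_filter_ringOfSetsType mu).
move=> x /(_ (Num.bound x)); apply.
by rewrite -ltr_norml; exact: unstable.ltr_norm_bound.
Qed.

Lemma lipschitz_mean_value a b c : a < b ->
  {ae mu, forall x, a < x < b -> exists2 d, d <= c & slope g x d} ->
  g b - g a <= c * (b - a).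
Proof.
move=> ab aec; have [f [fint aef fE]] := lipschitz_integral ab.
rewrite -lee_fin fE.
rewrite -integral_cst_oc//.
have : {ae mu, forall x, a < x < b -> f x <= c}.
  apply: filterS2 aef aec; first exact: (ae_filter_ringOfSetsType mu).
  move=> x fx cx xab; have [d dc sd] := cx xab.
  by rewrite -(slope_unique sd (fx xab)).
move=> [N [mN muN0 fN]].
(* The slope is controlled on the open interval only, so the endpoint b joins the exceptional
   set. *)
have mbN : measurable (b |` N : set (measurableTypeR R)) by exact: measurableU.
have bN0 : mu (b |` N) = 0%E.
  by rewrite [LHS]measureU0//; exact: lebesgue_measure_set1.
rewrite (negligible_integral mbN)// [leRHS](negligible_integral mbN)//; last first.
  exact: integrable_cst_oc.
apply: le_integral; first exact: measurableD.
- by apply: integrableS fint => //; exact: measurableD.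
- by apply: integrableS (integrable_cst_oc a b c) => //; exact: measurableD.
- move=> x; rewrite inE => -[/=]; rewrite in_itv/= => /andP[ax xb] /not_orP[xNb xN].
  rewrite lee_fin; apply: contrapT => fxc; apply: xN; apply: fN => /=; apply: contra_not fxc; apply.
  by rewrite ax lt_neqAle xb andbT; exact/eqP.
Qed.

End Lipschitz.
End OneDim.

(** * Sets that are null on every line of a given direction *)

Section LineNull.
Variables (R : realType) (X : normedModType R).
Local Notation mu := (@lebesgue_measure R).
Local Notation BX := (g_sigma_algebraType (@open X)).
Implicit Types (e v w x : X) (E : set X).

Definition borel E : Prop := measurable (E : set BX).

Lemma open_borel E : open E -> borel E.
Proof. exact: sub_sigma_algebra. Qed.

Lemma closed_borel E : closed E -> borel E.
Proof.
move=> /closed_openC/open_borel; rewrite /borel => h.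
by rewrite -(setCK E); exact: measurableC.
Qed.

Lemma borel_bigcup (I : countType) (E : I -> set X) :
  (forall i, borel (E i)) -> borel (\bigcup_i E i).
Proof. by move=> bE; exact: (@countable_bigcupT_measurable _ BX I E). Qed.

Lemma borel_bigcap (I : countType) (E : I -> set X) :
  (forall i, borel (E i)) -> borel (\bigcap_i E i).
Proof.
move=> bE; rewrite /borel -(setCK (\bigcap_i E i)) setC_bigcap.
apply: measurableC; apply: (borel_bigcup (E := fun i => ~` E i)) => i.
exact: (@measurableC _ BX (E i)) (bE i).
Qed.

Definition null_along e E := forall x, mu [set t | E (x + t *: e)] = 0%E.

(** For an arbitrary U: a point of the open ball that lies outside U is still in the ball after x
    has moved slightly. These are the Borel factors of the rectangles in
    [measurable_translation]. *)
Lemma closed_ball_inside (U : set X) (s : R) (z : X) :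
  closed [set x | ball (x + z) s `<=` U].
Proof.
set A := [set x | _]; rewrite -(setCK A); apply: open_closedC; rewrite openE => x /= /existsNP[y /not_implyP[xy Uy]].
move: xy; rewrite -ball_normE /= => xy.
apply/nbhs_normP; exists (s - `|x + z - y|); first by rewrite /= subr_gt0.
move=> x' /= xx' /(_ y); apply: contra_not Uy; apply.
rewrite -ball_normE/= -(subrK (x + z) (x' + z)) -addrA.
rewrite (le_lt_trans (ler_normD _ _))// opprD addrACA subrr addr0 distrC.
by rewrite -ltrBrDr.
Qed.

(** The preimage of an open U is exhibited as a countable union of rectangles: t within 1 / (n + 1)
    of a rational q, and x such that the ball of radius c / (n + 1) around x + q e lies in U. Since
    c exceeds |e|, replacing q by t stays in that ball. *)
Lemma measurable_translation e :
  measurable_fun setT (fun p : BX * measurableTypeR R => (p.1 + p.2 *: e : BX)).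
Proof.
apply: (@measurability _ _ (BX * measurableTypeR R)%type BX setT _ (@open X)) => // _ [U oU <-]; rewrite setTI.
pose c := `|e| + 1; have c0 : 0 < c by rewrite ltr_pwDr.
pose A (q : rat) (n : nat) := [set x : X | ball (x + ratr q *: e) (c / n.+1%:R) `<=` U].
have -> : (fun p : BX * measurableTypeR R => (p.1 + p.2 *: e : BX)) @^-1` U =
   \bigcup_q \bigcup_n ((A q n : set BX) `*`
      (ball (ratr q : R) n.+1%:R^-1 : set (measurableTypeR R))).
  apply/seteqP; split => [[x t]|[x t] [q _ [n _ [/= Ax tq]]]] /=; last first.
    apply: Ax; rewrite -ball_normE/= opprD addrACA subrr add0r -scalerBl normrZ mulrC.
    apply: (@le_lt_trans _ _ (c * `|ratr q - t|)).
      by rewrite ler_wpM2r// /c lerDl.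
    by rewrite ltr_pM2l.
  move=> Uxt; move: oU; rewrite openE => /(_ _ Uxt)/nbhs_normP[r /= r0 rU].
  have [n nr] : exists n : nat, 2 * c / n.+1%:R < r.
    exists (Num.bound (r^-1 * (2 * c))); rewrite ltr_pdivrMr// -ltr_pdivrMl//.
    by apply: (lt_le_trans (ltr_bound _)); rewrite ler_nat.
  have n0 : 0 < n.+1%:R^-1 :> R by rewrite invr_gt0.
  have [q] : exists q : rat, ratr q \in `]t, t + n.+1%:R^-1[.
    by apply: rat_in_itvoo; rewrite ltrDl.
  rewrite in_itv/= => /andP[tq qt]; exists q => //; exists n => //; split => /=.
    move=> y; rewrite -ball_normE/= => qy; apply: rU; rewrite /ball_/=.
    rewrite -(subrK (x + ratr q *: e) (x + t *: e)) -addrA.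
    rewrite (le_lt_trans (ler_normD _ _))//.
    apply: le_lt_trans nr; rewrite -mulrA mulr_natl mulr2n.
    apply: lerD; last exact: ltW.
    rewrite opprD addrACA subrr add0r -scalerBl normrZ mulrC ler_pM//.
      by rewrite lerDl.
    by rewrite distrC ger0_norm ?subr_ge0 ?ltW// ltrBlDl.
  by rewrite -ball_normE/= ger0_norm ?subr_ge0 ?ltW// ltrBlDl.
apply: bigcupT_measurable_rat => q; apply: bigcupT_measurable => n.
apply: measurableX; last by apply: open_measurable; exact: ball_open.
by apply: closed_borel; exact: closed_ball_inside.
Qed.

Lemma borel_line E x e : borel E ->
  measurable ([set t | E (x + t *: e)] : set (measurableTypeR R)).
Proof.
move=> bE; have := @measurable_fun_pair2 _ _ _ BX (measurableTypeR R) BX _ x (measurable_translation e).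
by move=> /(_ measurableT E bE); rewrite setTI.
Qed.

(** The exceptional set of Fubini's theorem: a generic line in direction e is one through a point
    outside it. *)
Definition shadow e E := [set x | mu [set t | E (x + t *: e)] <> 0%E].

Let translation_preimage e E := (fun p : BX * measurableTypeR R => (p.1 + p.2 *: e : BX)) @^-1` E.

Let measurable_translation_preimage e E : borel E -> measurable (translation_preimage e E).
Proof. by move=> bE; rewrite -[_ e E]setTI; exact: measurable_translation. Qed.

Lemma borel_shadow e E : borel E -> borel (shadow e E).
Proof.
move=> bE; pose A := translation_preimage e E.
have mA : measurable A by exact: measurable_translation_preimage.
have := @measurable_fun_xsection _ _ BX (measurableTypeR R) R mu A mA.
have m0 : measurable (~` [set 0%E] : set (\bar R)).
  by apply: measurableC; exact: emeasurable_set1.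
move=> /(_ measurableT _ m0); rewrite setTI.
congr measurable; apply/seteqP; split => x /=; rewrite /shadow/= xsectionE//=.
Qed.

(* Fubini in the plane x + span(v, w). *)
Lemma null_along_shadow v w E : borel E -> null_along v E ->
  null_along v (shadow w E).
Proof.
move=> bE vE x.
pose S := [set p : measurableTypeR R * measurableTypeR R | E (x + p.1 *: v + p.2 *: w)].
have mS : measurable S.
  pose h (p : measurableTypeR R * measurableTypeR R) : BX * measurableTypeR R :=
    (x + p.1 *: v, p.2).
  have mh : measurable_fun setT h.
    apply: measurable_fun_pair => //.
    have := @measurable_fun_pair2 _ _ _ BX (measurableTypeR R) BX _ x (measurable_translation v).
    by move=> mx; exact: (measurableT_comp mx measurable_fst).
  have := mh measurableT _ (@measurable_translation_preimage w E bE).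
  by rewrite setTI.
have := indic_fubini_tonelli mu mu mS.
rewrite indic_fubini_tonelli_FE// indic_fubini_tonelli_GE//.
rewrite [in X in _ = X -> _]integral0_eq; last first.
  move=> t _ /=; rewrite ysectionE/=.
  rewrite -[RHS](vE (x + t *: w)); congr (mu _).
  by apply/seteqP; split => s /=; rewrite addrAC.
move=> S0; have mf := measurable_fun_xsection mu mS.
have [+ _] := ae_eq_integral_abs mu measurableT mf.
rewrite (eq_integral (mu \o xsection S)); last by move=> s _ /=; rewrite gee0_abs.
move=> /(_ S0) [N [mN N0 SN]].
apply: (@subset_measure0 _ _ _ mu _ N) => //; first exact: borel_line (borel_shadow _ bE).
apply: subset_trans SN => s /=; rewrite /shadow/= => Es; apply: contra_not Es => /(_ I).
by rewrite xsectionE.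
Qed.

Lemma null_along_shadow0 e E x : borel E -> ~ shadow e E x -> mu.-negligible [set t | E (x + t *: e)].
Proof.
move=> bE /contrapT m0; apply/negligibleP => //; exact: borel_line.
Qed.

Lemma ae_small (S : set R) r : 0 < r -> mu.-negligible S ->
  exists2 t, ~ S t & `|t| < r.
Proof.
move=> r0 [N [mN N0 SN]]; apply: contrapT => h.
have /(le_measure mu) : `]0, r[ `<=` N.
  move=> t /=; rewrite in_itv/= => /andP[t0 tr]; apply: SN.
  by apply: contrapT => St; apply: h; exists t => //; rewrite gtr0_norm.
rewrite !inE => /(_ (measurable_itv _) mN).
rewrite [leLHS]lebesgue_measure_itv/= lte_fin r0 oppr0 adde0 [leRHS]N0.
by rewrite lee_fin leNgt r0.
Qed.

(** With j the head of the list, the shadows in direction e j of the sets of the tail are still null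
    along their own directions, so the induction yields y near x outside all of them. On the line
    through y in direction e j every set is then null, E j by hypothesis and the others by the
    choice of y, and a small step along this line avoids them all. *)
Lemma avoid_null_along (I : choiceType) (s : seq I) (e : I -> X) (E : I -> set X) x r :
  0 < r -> (forall i, i \in s -> borel (E i) /\ null_along (e i) (E i)) ->
  exists2 y, `|y - x| < r & forall i, i \in s -> ~ E i y.
Proof.
elim: s E r => [|j s IH] E r r0 sE; first by exists x => //; rewrite subrr normr0.
have r20 : 0 < r / 2 by rewrite divr_gt0.
have sE' i : i \in s -> borel (E i) /\ null_along (e i) (E i).
  by move=> si; apply: sE; rewrite inE si orbT.
have [|y yx yE] := IH (fun i => shadow (e j) (E i)) _ r20.
  move=> i /sE'[bE nE]; split; first exact: borel_shadow.
  exact: null_along_shadow.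
have : mu.-negligible (\big[setU/set0]_(i <- j :: s) [set t | E i (y + t *: e j)]).
  rewrite big_seq; apply: big_ind => [|A B|i]; [exact: negligible_set0|exact: negligibleU|].
  rewrite inE => /predU1P[->|si].
    have [bE nE] := sE j (mem_head _ _).
    by apply/negligibleP; [exact: borel_line|exact: nE].
  by apply: null_along_shadow0 (yE _ si); have [] := sE' _ si.
have rj : 0 < r / 2 / (`|e j| + 1) by rewrite divr_gt0// ltr_pwDr.
move=> /(ae_small rj)[t tE tr]; exists (y + t *: e j).
  rewrite addrAC (le_lt_trans (ler_normD _ _))// (splitr r) ltrD// normrZ.
  apply: le_lt_trans (_ : `|t| * (`|e j| + 1) < _); first by rewrite ler_wpM2l// lerDl.
  by rewrite -ltr_pdivlMr// ltr_pwDr.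
by move=> i si Ei; apply: tE; rewrite -bigcup_seq; exists i.
Qed.

End LineNull.

(** * Differentiability of Lipschitz functions outside a null set *)

Section ApproxSlope.
Variable R : realType.

(** Slopes valid up to eta are within 2 eta of each other; the supremum of the lower slopes at 0+
    names their limit without a Cauchy sequence. This allows differentiability to be tested with
    rational slopes. *)
Lemma approx_slope (phi : R -> R) :
  (forall eta, 0 < eta -> exists q, exists2 del, 0 < del &
     forall t, `|t| < del -> `|phi t - q * t| <= eta * `|t|) ->
  exists d, forall eta, 0 < eta -> exists2 del, 0 < del &
     forall t, `|t| < del -> `|phi t - d * t| <= eta * `|t|.
Proof.
move=> H; pose A := [set a | exists2 del, 0 < del &
  forall t, 0 < t -> t < del -> a * t <= phi t].
have HA eta q del : 0 < eta -> 0 < del ->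
    (forall t, `|t| < del -> `|phi t - q * t| <= eta * `|t|) ->
    A (q - eta) /\ ubound A (q + eta).
  move=> e0 d0 D; split.
    exists del => // t t0 td; have := D t; rewrite gtr0_norm// => /(_ td).
    by rewrite ler_norml => /andP[+ _]; rewrite mulrBl; lra.
  move=> a [s s0 sa]; pose t := Num.min del s / 2.
  have m0 : 0 < Num.min del s by rewrite lt_min d0.
  have t0 : 0 < t by rewrite divr_gt0.
  have : t < Num.min del s by rewrite /t ltr_pdivrMr// ltr_pMr// ltr1n.
  rewrite lt_min => /andP[td /(sa _ t0) at_].
  have := D t; rewrite gtr0_norm// => /(_ td); rewrite ler_norml => /andP[_ pt].
  by rewrite -(ler_pM2r t0) mulrDl; lra.
exists (sup A) => eta e0; have e20 : 0 < eta / 2 by rewrite divr_gt0.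
have [q [del del0 D]] := H _ e20; exists del => // t /D.
have [Aq Uq] := HA _ _ _ e20 del0 D.
have l1 : q - eta / 2 <= sup A by apply: ub_le_sup => //; exists (q + eta / 2).
have l2 : sup A <= q + eta / 2 by apply: ge_sup => //; exists (q - eta / 2).
move=> ht; have -> : phi t - sup A * t = (phi t - q * t) + (q - sup A) * t by ring.
rewrite (le_trans (ler_normD _ _))// [leRHS](_ : _ = eta / 2 * `|t| + eta / 2 * `|t|); last by field.
by rewrite lerD// normrM ler_wpM2r// ler_norml; apply/andP; split; lra.
Qed.

End ApproxSlope.

Section DirectionalSlope.
Variables (R : realType) (X : normedModType R).
Local Notation mu := (@lebesgue_measure R).
Implicit Types (g : X -> R) (e x w : X) (A : set X).

Definition dirslope g e x (d : R) := forall eta, 0 < eta ->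
  exists2 del, 0 < del & forall t, `|t| < del ->
    `|g (x + t *: e) - g x - d * t| <= eta * `|t|.

Lemma dirslope_slope g e x t d :
  slope (fun t => g (x + t *: e)) t d <-> dirslope g e (x + t *: e) d.
Proof.
split=> h eta e0; have [del d0 D] := h _ e0; exists del => // s /D;
  by rewrite scalerDl addrA.
Qed.

Definition klip (L : R) g := forall x y, `|g x - g y| <= L * `|x - y|.

(** For fixed t the increment is 2K-Lipschitz in x, so a violated inequality remains violated
    nearby, and an intersection of closed conditions is closed. *)
Lemma closed_increments (T : Type) g L (P : set T) (h : T -> X) (b c : T -> R) :
  klip L g ->
  closed [set x | forall t, P t -> `|g (x + h t) - g x - b t| <= c t].
Proof.
move=> gL; set A := [set x | _]; rewrite -(setCK A); apply: open_closedC.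
rewrite openE => x /= /existsNP[t /not_implyP[Pt /negP]]; rewrite -ltNge => ct.
pose K := `|L| + 1; have K0 : 0 < K by rewrite ltr_pwDr.
apply/nbhs_normP; exists ((`|g (x + h t) - g x - b t| - c t) / (2 * K)) => /=.
  by rewrite divr_gt0 ?subr_gt0// mulr_gt0.
move=> y /=; rewrite ltr_pdivlMr ?mulr_gt0// => xy /(_ t Pt).
have gK u v : `|g u - g v| <= K * `|u - v|.
  by rewrite (le_trans (gL _ _))// ler_wpM2r// (le_trans (ler_norm _))// lerDl.
have h1 : `|g (x + h t) - g (y + h t)| <= K * `|x - y|.
  by rewrite (le_trans (gK _ _))// opprD addrACA subrr addr0.
have h2 := gK x y.
have := ler_normD (g (y + h t) - g y - b t) (g (x + h t) - g (y + h t) - (g x - g y)).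
have := ler_normB (g (x + h t) - g (y + h t)) (g x - g y).
have -> : g (y + h t) - g y - b t + (g (x + h t) - g (y + h t) - (g x - g y)) =
  g (x + h t) - g x - b t by ring.
lra.
Qed.

Definition nondiff g e := [set x | ~ exists d, dirslope g e x d].

Lemma exists_natinv (r : R) : 0 < r -> exists k : nat, k.+1%:R^-1 < r.
Proof.
move=> r0; exists (Num.bound r^-1).
rewrite invf_plt ?posrE//; apply: (lt_trans (ltr_bound _)).
by rewrite ltr_nat.
Qed.

(** An error of 1 / (m + 1) leaves room for a rational slope q, so differentiability is a countable
    combination of the closed conditions C m q k; [approx_slope] recovers the true slope. *)
Lemma borel_nondiff g L e : klip L g -> borel (nondiff g e).
Proof.
move=> gL; pose C (m : nat) (q : rat) (k : nat) := [set x | forall t : R,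
  `|t| < k.+1%:R^-1 -> `|g (x + t *: e) - g x - ratr q * t| <= m.+1%:R^-1 * `|t|].
have -> : nondiff g e = ~` \bigcap_m \bigcup_q \bigcup_k C m q k.
  apply/seteqP; split => x; apply: contra_not.
    move=> Cx; apply: (@approx_slope R (fun t => g (x + t *: e) - g x)) => eta e0.
    have [m me] := exists_natinv e0.
    have [q _ [k _ Cq]] := Cx m I; exists (ratr q); exists k.+1%:R^-1 => // t /Cq.
    by move=> /le_trans; apply; rewrite ler_wpM2r// ltW.
  move=> [d dx] m _; rewrite /C; move: (m.+1%:R^-1) (invr_gt0 (m.+1%:R : R)) => c; rewrite ltr0n => c0.
  have m0 : 0 < c / 2 by rewrite divr_gt0.
  have [q] : exists q : rat, ratr q \in `]d, d + c / 2[.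
    by apply: rat_in_itvoo; rewrite ltrDl.
  rewrite in_itv/= => /andP[dq qd]; exists q => //.
  have [del del0 D] := dx _ m0; have [k kd] := exists_natinv del0; exists k => // t tk.
  have := D t (lt_trans tk kd).
  have : `|(d - ratr q) * t| <= c / 2 * `|t|.
    by rewrite normrM ler_wpM2r// ler_norml; apply/andP; split; lra.
  have := ler_normD (g (x + t *: e) - g x - d * t) ((d - ratr q) * t).
  have -> : g (x + t *: e) - g x - d * t + (d - ratr q) * t = g (x + t *: e) - g x - ratr q * t by ring.
  lra.
rewrite /borel; apply: measurableC; apply: (borel_bigcap (E := fun m => \bigcup_q \bigcup_k C m q k)) => m.
apply: (borel_bigcup (E := fun q => \bigcup_k C m q k)) => q.
apply: (borel_bigcup (E := fun k => C m q k)) => k.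
apply: closed_borel.
exact: (@closed_increments R g L [set t | `|t| < k.+1%:R^-1] (fun t => t *: e)
  (fun t => ratr q * t) (fun t => m.+1%:R^-1 * `|t|)).
Qed.

Lemma null_along_nondiff g L e : klip L g -> null_along e (nondiff g e).
Proof.
move=> gL x.
have : {ae mu, forall t, exists d, slope (fun t => g (x + t *: e)) t d}.
  apply: (@lipschitz_ae_slope _ _ (`|L| * `|e|)) => s t.
  rewrite (le_trans (gL _ _))// opprD addrACA subrr add0r -scalerBl normrZ.
  by rewrite [`|s - t| * _]mulrC mulrA !ler_wpM2r// ler_norm.
move=> H; apply: measure_negligible; first exact: borel_line (borel_nondiff e gL).
apply: negligibleS H => t /= Nx [d /dirslope_slope dx]; apply: Nx.
by exists d.
Qed.

End DirectionalSlope.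

(** * Distance to a set *)

Section Distance.
Variables (R : realType) (X : normedModType R).
Implicit Types (x y : X) (A : set X).

(** For empty A the default value of [inf] makes this 0, so the Lipschitz bound holds for every
    A. *)
Definition dist_to A x := inf [set `|x - y| | y in A].

Let lb A x : has_lbound [set `|x - y| | y in A].
Proof. by exists 0 => _ [y _ <-]. Qed.

Lemma dist_to_ge0 A x : 0 <= dist_to A x.
Proof.
have [->|/set0P[y Ay]] := eqVneq A set0; first by rewrite /dist_to image_set0 inf0.
by apply: lb_le_inf; [exists `|x - y|; exists y|move=> _ [z _ <-]].
Qed.

Lemma dist_to_mem A x : A x -> dist_to A x = 0.
Proof.
move=> Ax; apply/eqP; rewrite eq_le dist_to_ge0 andbT -(normr0 X) -(subrr x).
by apply: ge_inf => //; exists x.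
Qed.

Lemma dist_to_lt A x r : A !=set0 -> dist_to A x < r -> exists2 y, A y & `|x - y| < r.
Proof.
move=> [z Az] xr; have [|_ [y Ay <-] yr] := inf_lt _ xr; last by exists y.
by exists `|x - z|; exists z.
Qed.

Lemma dist_to_lip A : klip 1 (dist_to A).
Proof.
have [->|/set0P[z Az]] := eqVneq A set0.
  by move=> x y; rewrite /dist_to !image_set0 subrr normr0 mul1r.
have h x y : dist_to A x - dist_to A y <= `|x - y|.
  rewrite lerBlDl -lerBlDr; apply: lb_le_inf; first by exists `|y - z|; exists z.
  move=> _ [w Aw <-]; rewrite lerBlDr.
  apply: (@le_trans _ _ `|x - w|); first by apply: ge_inf => //; exists w.
  by rewrite -(subrK y x) -addrA addrC (le_trans (ler_normD _ _))// addrK.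
by move=> x y; rewrite mul1r ler_norml h andbT lerNl opprB distrC h.
Qed.

End Distance.

(** * Rademacher's theorem for scalar functions *)

Section Rademacher.
Variables (R : realType) (X : normedModType R) (n : nat).
Variables (e : 'I_n -> X) (c : 'I_n -> X -> R).
Hypothesis c_lin : forall i (a : R) u v, c i (a *: u + v) = a * c i u + c i v.
Hypothesis c_le : forall i x, `|c i x| <= `|x|.
Hypothesis c_e : forall i j, c i (e j) = (i == j)%:R.
Hypothesis e_norm : forall i, `|e i| <= 1.
Hypothesis e_span : forall x, x = \sum_i c i x *: e i.
Local Notation mu := (@lebesgue_measure R).
Implicit Types (g : X -> R) (x w : X) (E : set X).

(* The sigma-ideal of Aronszajn null sets for the directions e. *)
Definition lnull E := exists F : 'I_n -> set X,
  (forall i, borel (F i) /\ null_along (e i) (F i)) /\ E `<=` \bigcup_i F i.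

Lemma lnull_sub E E' : E `<=` E' -> lnull E' -> lnull E.
Proof. by move=> EE' [F [bF EF]]; exists F; split => //; exact: subset_trans EF. Qed.

Lemma lnull0 : lnull set0.
Proof.
exists (fun=> set0); split=> // i; split; first exact: (@measurable0 _ (g_sigma_algebraType (@open X))).
by move=> x; rewrite -(measure0 mu); congr (mu _); apply/seteqP; split.
Qed.

Lemma lnull_bigcup (I : countType) (E : I -> set X) :
  (forall i, lnull (E i)) -> lnull (\bigcup_i E i).
Proof.
move=> /choice[F FP]; exists (fun k => \bigcup_i F i k); split; last first.
  move=> x [i _ Ex]; have [_ /(_ x Ex)[k _ Fx]] := FP i.
  by exists k => //; exists i.
move=> k; have bF : borel (\bigcup_i F i k).
  by apply: (borel_bigcup (E := fun i => F i k)) => i; have [/(_ k)[]] := FP i.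
split=> // x; apply: measure_negligible; first exact: borel_line.
(* The index type is enumerated by its codes in nat; a number that codes nothing contributes the
   empty set. *)
have -> : [set t | (\bigcup_i F i k) (x + t *: e k)] =
    \bigcup_m [set t | exists2 i, unpickle m = Some i & F i k (x + t *: e k)].
  apply/seteqP; split => [t [i _ Fi]|t [m _ [i _ Fi]]]; last by exists i.
  by exists (pickle i) => //=; exists i => //; rewrite pickleK.
apply: negligible_bigcup => m; case: (unpickle m) => [i|]; last first.
  by apply: negligibleS (negligible_set0 _) => t [].
have [/(_ k)[bi ni] _] := FP i.
apply: (@negligibleS _ _ _ mu [set t | F i k (x + t *: e k)]).
  by move=> t /= [_ [<-]].
by apply/negligibleP; [exact: borel_line|exact: ni].
Qed.

Lemma lnullU E E' : lnull E -> lnull E' -> lnull (E `|` E').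
Proof.
move=> nE nE'; apply: (@lnull_sub _ (\bigcup_(b : bool) if b then E else E')).
  by move=> x [Ex|Ex]; [exists true|exists false].
by apply: lnull_bigcup => -[].
Qed.

Lemma lnull_nondiff g L i : klip L g -> lnull (nondiff g (e i)).
Proof.
move=> gL; exists (fun j => if j == i then nondiff g (e i) else set0); split.
  move=> j; case: eqP => [->|_].
    by split; [exact: borel_nondiff gL|exact: null_along_nondiff gL].
  split; first exact: (@measurable0 _ (g_sigma_algebraType (@open X))).
  by move=> x; rewrite -(measure0 mu); congr (mu _); apply/seteqP; split.
by move=> x nx; exists i => //; rewrite eqxx.
Qed.

(** The shadows of the pieces in direction w remain null along their basis vectors, so some y near x
    avoids them all, and every piece is null on the line through y. The direction w is arbitrary; w
    = 0 gives density of the complement of E. *)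
Lemma lnull_avoid E w x r : lnull E -> 0 < r ->
  exists2 y, `|y - x| < r & mu.-negligible [set t | E (y + t *: w)].
Proof.
move=> [F [FP EF]] r0.
have [i _|y yx yF] := @avoid_null_along _ _ _ (enum 'I_n) e (fun i => shadow w (F i)) x r r0.
  by have [bF nF] := FP i; split; [exact: borel_shadow|exact: null_along_shadow].
exists y => //.
have bF i : borel (F i) by have [] := FP i.
apply: (@negligibleS _ _ _ mu (\big[setU/set0]_(i < n) [set t | F i (y + t *: w)])).
  by move=> t /EF[i _ Fi]; rewrite -bigcup_seq; exists i => //=; rewrite mem_index_enum.
apply: big_ind => [|A B|i _]; [exact: negligible_set0|exact: negligibleU|].
by apply: null_along_shadow0 (bF i) _; apply: yF; rewrite mem_enum.
Qed.

Definition lform (a : 'I_n -> rat) x := \sum_i ratr (a i) * c i x.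

(* The span of e_0, ..., e_(j-1). *)
Definition subspan (j : nat) := [set h | forall i : 'I_n, (j <= i)%N -> c i h = 0].

Definition approx_at g (j : nat) (eps : R) (a : 'I_n -> rat) (k : nat) : set X :=
  [set x | forall h, subspan j h /\ `|h| < k.+1%:R^-1 ->
     `|g (x + h) - g x - lform a h| <= eps * `|h| ].

(** Fréchet differentiability along the first j basis vectors, with rational linear forms
    approximating the derivative. Only countably many sets [approx_at] occur, and each costs one
    null set in the induction on j. *)
Definition fdiff_upto g j := [set x | forall m : nat, exists (a : {ffun 'I_n -> rat}) k,
  approx_at g j m.+1%:R^-1 a k x].

Lemma fdiff_upto0 g x : fdiff_upto g 0 x.
Proof.
move=> m; exists [ffun=> 0], 0%N => h [/(_ _ (leq0n _)) h0 _].
have -> : h = 0 by rewrite (e_span h); apply: big1 => i _; rewrite h0 scale0r.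
rewrite addr0 subrr normr0 mulr0 /lform big1 ?subrr ?normr0// => i _.
by rewrite ffunE rmorph0 mul0r.
Qed.

(* The distance to the set A of approximation points that contains x is
   differentiable along e_j at x and minimal there, so its slope vanishes:
   x + s e_j is within o(s) of a point p of A, and the linear approximation
   along the first j directions that holds at p transfers to x + s e_j. *)
Lemma fdiff_uptoS g L (j : 'I_n) x : klip L g ->
  fdiff_upto g j x -> ~ nondiff g (e j) x ->
  (forall m (a : {ffun 'I_n -> rat}) k,
     ~ nondiff (dist_to (approx_at g j m.+1%:R^-1 a k)) (e j) x) ->
  fdiff_upto g j.+1 x.
Proof.
move=> gL fx /contrapT[d gd] dK m.
move: (m.+1%:R^-1) (invr_gt0 (m.+1%:R : R)) => eta; rewrite ltr0n => eta0.
pose K := `|L| + 1; have K0 : 0 < K by rewrite ltr_pwDr.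
have gK u v : `|g u - g v| <= K * `|u - v|.
  by rewrite (le_trans (gL _ _))// ler_wpM2r// (le_trans (ler_norm _))// lerDl.
(* Error budget: as |s| <= |h|, the bounds e1 to e5 below add up to at most (1/4 + 1/4 + 1/8 + 1/8 +
   1/8) eta |h|. The 16 absorbs the factor 2 in |h'| <= 2 |h|. *)
have eta16 : 0 < eta / 16 by rewrite divr_gt0.
have [m' m'eta] := exists_natinv eta16; have [a [k xA]] := fx m'.
have /contrapT[d0 dd0] := dK m' a k.
set A := approx_at _ _ _ _ _ in xA dd0.
have d00 : d0 = 0.
  apply/eqP; rewrite -normr_le0; apply/ler_addgt0Pr => r r0; rewrite add0r.
  have [del del0 D] := dd0 _ r0; pose t := del / 2.
  have t0 : 0 < t by rewrite divr_gt0.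
  have tdel : t < del by rewrite /t ltr_pdivrMr// ltr_pMr// ltr1n.
  have := D t; have := D (- t); rewrite normrN gtr0_norm// => /(_ tdel) + /(_ tdel).
  rewrite (dist_to_mem xA) !subr0 !ler_norml => /andP[_ h1] /andP[_ h2].
  have p1 := dist_to_ge0 A (x + - t *: e j); have p2 := dist_to_ge0 A (x + t *: e j).
  by apply/andP; split; rewrite -(ler_pM2r t0); lra.
have eta8 : 0 < eta / 8 by rewrite divr_gt0.
have eta2 : 0 < eta / 8 / K by rewrite divr_gt0.
have [q] : exists q : rat, ratr q \in `]d, d + eta / 8[.
  by apply: rat_in_itvoo; rewrite ltrDl.
rewrite in_itv/= => /andP[dq qd].
have [del1 del10 D1] := gd _ eta8.
have [del2 del20 D2] := dd0 _ eta2.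
have k0 : 0 < k.+1%:R^-1 / 2 :> R by rewrite divr_gt0// invr_gt0 ltr0n.
have : 0 < Num.min (k.+1%:R^-1 / 2) (Num.min del1 del2) by rewrite !lt_min k0 del10.
move=> /exists_natinv[k2]; rewrite !lt_min => /and3P[k2k k2d1 k2d2].
(* The form valid along the first j directions is kept there and receives the rational slope q along
   e j. *)
exists [ffun i => if i == j then q else a i], k2 => h [hj hk].
pose s := c j h; pose h' := h - s *: e j.
have sh : `|s| <= `|h| by exact: c_le.
have ch' i : c i h' = c i h - s * (i == j)%:R.
  by rewrite /h' addrC -scaleNr c_lin c_e mulNr addrC.
have h'j : subspan j h'.
  move=> i ji; rewrite ch'; have [->|ij] := eqVneq i j; first by rewrite mulr1 subrr.
  by rewrite mulr0 subr0; apply: hj; rewrite ltn_neqAle ji andbT eq_sym.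
have h'h : `|h'| <= 2 * `|h|.
  rewrite (le_trans (ler_normB _ _))// mulr_natl mulr2n lerD2l normrZ.
  by rewrite -[leRHS]mulr1 ler_pM.
have h'k : `|h'| < k.+1%:R^-1.
  by apply: le_lt_trans h'h _; rewrite mulrC -ltr_pdivlMr// (lt_trans hk).
have formE : lform [ffun i => if i == j then q else a i] h = lform a h' + ratr q * s.
  rewrite /lform (bigD1 j)//= ffunE eqxx [in RHS](bigD1 j)//= ch' eqxx mulr1 subrr mulr0 add0r addrC.
  by congr (_ + _); apply: eq_bigr => i /negPf ij; rewrite ffunE ij ch' ij mulr0 subr0.
have [p Ap xp] : exists2 p, A p & `|x + s *: e j - p| <= eta / 4 / K * `|s|.
  have [->|s0] := eqVneq s 0; first by exists x => //; rewrite scale0r addr0 subrr !normr0 mulr0.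
  have := D2 s (le_lt_trans sh (lt_trans hk k2d2)).
  rewrite d00 mul0r subr0 (dist_to_mem xA) subr0 ger0_norm ?dist_to_ge0// => Ds.
  have [||p Ap ?] := @dist_to_lt _ _ A (x + s *: e j) (eta / 4 / K * `|s|).
  - by exists x.
  - apply: le_lt_trans Ds _; rewrite ltr_pM2r ?normr_gt0// ltr_pM2r ?invr_gt0//.
    by rewrite ltr_pM2l// ltf_pV2 ?posrE// ltr_nat.
  - by exists p => //; exact: ltW.
have e1 : `|g (x + h) - g (p + h')| <= eta / 4 * `|s|.
  rewrite (le_trans (gK _ _))//.
  have -> : x + h - (p + h') = x + s *: e j - p.
    by rewrite /h' opprD opprB addrACA (addrC h) subrK addrAC.
  by rewrite mulrC -ler_pdivlMr// (le_trans xp)// mulrAC.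
have e2 : `|g (x + s *: e j) - g p| <= eta / 4 * `|s|.
  by rewrite (le_trans (gK _ _))// mulrC -ler_pdivlMr// (le_trans xp)// mulrAC.
have e3 : `|g (p + h') - g p - lform a h'| <= eta / 16 * (2 * `|h|).
  apply: le_trans (Ap h' _) _; first by split.
  by apply: ler_pM => //; exact: ltW.
have e4 := D1 s (le_lt_trans sh (lt_trans hk k2d1)).
have e5 : `|(d - ratr q) * s| <= eta / 8 * `|s|.
  by rewrite normrM ler_wpM2r// ler_norml; apply/andP; split; lra.
have : eta * `|s| <= eta * `|h| by rewrite ler_wpM2l// ltW.
have : 0 <= eta * `|h| by rewrite mulr_ge0// ltW.
rewrite formE.
have -> : g (x + h) - g x - (lform a h' + ratr q * s) =
  (g (x + h) - g (p + h')) + (g (p + h') - g p - lform a h') - (g (x + s *: e j) - g p)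
  + (g (x + s *: e j) - g x - d * s) + (d - ratr q) * s by ring.
move: e1 e2 e3 e4 e5.
set z1 := g (x + h) - _; set z2 := g (p + h') - _ - _; set z3 := g (x + _) - g p.
set z4 := g (x + _) - g x - _; set z5 := _ * s.
have := ler_normD (z1 + z2 - z3 + z4) z5; have := ler_normD (z1 + z2 - z3) z4.
have := ler_normB (z1 + z2) z3; have := ler_normD z1 z2.
lra.
Qed.

Lemma lnull_fdiff g L : klip L g -> forall j, (j <= n)%N -> lnull (~` fdiff_upto g j).
Proof.
move=> gL; elim=> [_|j IH jn].
  by apply: (@lnull_sub _ set0 _ lnull0) => x /(_ (@fdiff_upto0 g x)).
pose J := Ordinal jn.
pose B (p : nat * {ffun 'I_n -> rat} * nat) :=
  nondiff (dist_to (approx_at g j p.1.1.+1%:R^-1 p.1.2 p.2)) (e J).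
apply: (@lnull_sub _ (~` fdiff_upto g j `|` (nondiff g (e J) `|` \bigcup_p B p))).
  move=> x nfx; have [fx|] := pselect (fdiff_upto g j x); last by left.
  have [gx|gx] := pselect (nondiff g (e J) x); first by right; left.
  right; right; apply: contrapT => Bx; apply: nfx.
  apply: (@fdiff_uptoS g L J) => // m a k nx; apply: Bx; by exists (m, a, k).
apply: lnullU; first exact: IH (ltnW jn).
apply: lnullU; first exact: lnull_nondiff gL.
by apply: lnull_bigcup => p; apply: lnull_nondiff; exact: dist_to_lip.
Qed.

(** For j = n the approximating forms act on the whole space. They give a slope in each direction by
    [approx_slope]; the slopes are linear in the direction because, for every eps, a single linear
    form is uniformly close to all of them. *)
Lemma lnull_not_gateaux g L : klip L g -> lnull
  [set x | ~ exists2 l : X -> R, forall (a : R) u v, l (a *: u + v) = a * l u + l v &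
                     forall w, dirslope g w x (l w)].
Proof.
move=> /lnull_fdiff/(_ n (leqnn n)); apply: lnull_sub => x nl fx; apply: nl.
have c0 i : c i 0 = 0 by have := c_lin i 1 0 0; rewrite scaler0 addr0 mul1r; lra.
have key eta : 0 < eta -> exists (a : {ffun 'I_n -> rat}), exists2 del, 0 < del &
    forall h, `|h| < del -> `|g (x + h) - g x - lform a h| <= eta * `|h|.
  move=> eta0; have [m me] := exists_natinv eta0; have [a [k ak]] := fx m.
  exists a; exists k.+1%:R^-1 => // h hk; apply: le_trans (ak h _) _.
    by split => // i; rewrite leqNgt ltn_ord.
  by rewrite ler_wpM2r// ltW.
have lformD a (r : R) u v : lform a (r *: u + v) = r * lform a u + lform a v.
  rewrite /lform mulr_sumr -big_split/=; apply: eq_bigr => i _.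
  by rewrite c_lin; ring.
have lformZ a (r : R) u : lform a (r *: u) = r * lform a u.
  by rewrite -[r *: u]addr0 lformD /lform [X in _ + X]big1 ?addr0// => i _; rewrite c0 mulr0.
have /choice[l lP] : forall w, exists d, dirslope g w x d.
  move=> w; apply: (@approx_slope R (fun t => g (x + t *: w) - g x)) => eta eta0.
  have e1 : 0 < eta / (`|w| + 1) by rewrite divr_gt0// ltr_pwDr.
  have [a [del del0 D]] := key _ e1; exists (lform a w).
  exists (del / (`|w| + 1)); first by rewrite divr_gt0// ltr_pwDr.
  move=> t; rewrite ltr_pdivlMr ?ltr_pwDr// => tw.
  have tw' : `|t *: w| <= `|t| * (`|w| + 1) by rewrite normrZ ler_wpM2l// lerDl.
  have := D (t *: w) (le_lt_trans tw' tw); rewrite lformZ mulrC => /le_trans; apply.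
  rewrite (le_trans (ler_wpM2l (ltW e1) tw'))// mulrCA divfK ?gt_eqF ?ltr_pwDr//.
  by rewrite mulrC.
exists l => // b u v.
apply/eqP; rewrite -subr_eq0 -normr_le0; apply/ler_addgt0Pr => eps eps0; rewrite add0r.
(* The total weight with which the three errors enter the linearity defect, plus 1 to make it
   positive. *)
pose M := `|b *: u + v| + `|b| * `|u| + `|v| + 1.
have M0 : 0 < M by rewrite ltr_pwDr// !addr_ge0// mulr_ge0.
have [a [del del0 D]] := key _ (divr_gt0 eps0 M0).
have close w : `|l w - lform a w| <= eps / M * `|w|.
  apply/ler_addgt0Pr => r r0; have [del' del'0 D'] := lP w _ r0.
  pose s := Num.min (del / (`|w| + 1)) del' / 2.
  have m0 : 0 < Num.min (del / (`|w| + 1)) del' by rewrite lt_min divr_gt0 ?ltr_pwDr.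
  have s0 : 0 < s by rewrite divr_gt0.
  have : s < Num.min (del / (`|w| + 1)) del' by rewrite /s ltr_pdivrMr// ltr_pMr// ltr1n.
  rewrite lt_min ltr_pdivlMr ?ltr_pwDr// => /andP[sd sd'].
  have sw : `|s *: w| = s * `|w| by rewrite normrZ gtr0_norm.
  have := D (s *: w); rewrite sw lformZ => A1.
  have := D' s; rewrite gtr0_norm// => /(_ sd') A2.
  have {}A1 := A1 (le_lt_trans (ler_wpM2l (ltW s0) (ltW (ltr_pwDr ltr01 (lexx _)))) sd).
  rewrite -(ler_pM2l s0) -[s in s * `|_|](gtr0_norm s0) -normrM [leRHS]mulrDr.
  have -> : s * (l w - lform a w) = (g (x + s *: w) - g x - s * lform a w)
     - (g (x + s *: w) - g x - l w * s) by ring.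
  rewrite (le_trans (ler_normB _ _))//.
  have -> : s * (eps / M * `|w|) + s * r = eps / M * (s * `|w|) + r * s by ring. exact: lerD.
have -> : l (b *: u + v) - (b * l u + l v) = (l (b *: u + v) - lform a (b *: u + v))
   - (b * (l u - lform a u) + (l v - lform a v)) by rewrite lformD; ring.
rewrite (le_trans (ler_normB _ _))// (le_trans (lerD (close _) (ler_normD _ _)))//.
rewrite normrM (le_trans (lerD (lexx _) (lerD (ler_wpM2l _ (close u)) (close v))))//.
have -> : eps / M * `|b *: u + v| + (`|b| * (eps / M * `|u|) + eps / M * `|v|) =
  eps / M * (M - 1) by rewrite /M; ring.
by rewrite mulrAC ler_pdivrMr// ler_pM2l// gerBl.
Qed.

End Rademacher.

(** * Finite-dimensional inner product spaces *)

Section InnerProduct.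
Variables (R : realType) (X : normedModType R) (inner : {dot X for idfun}).
Hypothesis inner_norm : forall x : X, `|x| ^+ 2 = inner x x.
Implicit Types x y u v : X.

Lemma innerC u v : inner u v = inner v u.
Proof. by rewrite hermC/= expr0 mul1r. Qed.

Lemma innerDl u v w : inner (u + v) w = inner u w + inner v w.
Proof. exact: linearDl. Qed.

Lemma innerZl a u w : inner (a *: u) w = a * inner u w.
Proof. by rewrite linearZl_LR. Qed.

Lemma innerNl u w : inner (- u) w = - inner u w.
Proof. exact: linearNl. Qed.

Lemma innerBl u v w : inner (u - v) w = inner u w - inner v w.
Proof. exact: linearBl. Qed.

Lemma innerDr u v w : inner w (u + v) = inner w u + inner w v.
Proof. exact: linearDr. Qed.

Lemma innerZr a u w : inner w (a *: u) = a * inner w u.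
Proof. by rewrite innerC innerZl innerC. Qed.

Lemma innerBr u v w : inner w (u - v) = inner w u - inner w v.
Proof. exact: linearBr. Qed.

Lemma inner0l w : inner 0 w = 0.
Proof. by rewrite -(scale0r 0) innerZl mul0r. Qed.

Lemma inner_suml (I : Type) (r : seq I) (F : I -> X) w :
  inner (\sum_(i <- r) F i) w = \sum_(i <- r) inner (F i) w.
Proof. by elim/big_rec2: _ => [|i x y _ <-]; rewrite ?inner0l ?innerDl. Qed.

Lemma inner_le_unit x u : `|u| = 1 -> `|inner x u| <= `|x|.
Proof.
move=> u1; have := sqr_ge0 `|x - inner x u *: u|.
rewrite inner_norm innerBl !innerBr !innerZl !innerZr -!inner_norm u1 (innerC u x).
move=> h; rewrite -(@ler_pXn2r _ 2) ?nnegrE// real_normK ?num_real//.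
by move: h; rewrite expr1n !expr2; lra.
Qed.

Lemma inner_cauchy x y : `|inner x y| <= `|x| * `|y|.
Proof.
have [->|y0] := eqVneq y 0.
  by rewrite innerC inner0l !normr0 mulr0.
have yp : 0 < `|y| by rewrite normr_gt0.
have u1 : `| `|y|^-1 *: y| = 1 by rewrite normrZ gtr0_norm ?invr_gt0// mulVf// gt_eqF.
have := inner_le_unit x u1.
by rewrite innerZr normrM gtr0_norm ?invr_gt0// mulrC ler_pdivrMr.
Qed.

(** Gram-Schmidt; a vector with zero residual r is dropped, so s may be linearly dependent. *)
Lemma orthonormal_seq (s : seq X) : exists es : seq X,
  [/\ pairwise (fun u v => inner u v == 0) es, all (fun u => inner u u == 1) es &
    forall x, x \in s -> x = \sum_(v <- es) inner x v *: v].
Proof.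
elim: s => [|y s [es [po un sp]]]; first by exists [::].
pose r := y - \sum_(v <- es) inner y v *: v.
have ortho w : w \in es -> forall z, inner (\sum_(v <- es) inner z v *: v) w = inner z w.
  move=> wes z; rewrite inner_suml.
  elim: es po un wes {r sp} => // v es IH /= /andP[vall po] /andP[/eqP v1 un].
  rewrite inE big_cons innerZl => /predU1P[->|wes].
    rewrite v1 mulr1 [X in _ + X]big1_seq ?addr0// => u /andP[_ ues].
    by rewrite innerZl (innerC u) (eqP (allP vall _ ues)) mulr0.
  by rewrite (eqP (allP vall _ wes)) mulr0 add0r IH.
have r_ortho w : w \in es -> inner r w = 0.
  by move=> wes; rewrite /r innerBl ortho// subrr.
have [r0|r0] := eqVneq r 0.
  exists es; split => // x; rewrite inE => /predU1P[->|]; last exact: sp.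
  by apply/eqP; rewrite -subr_eq0 -/r r0.
have rp : `|r| != 0 by rewrite normr_eq0.
exists ((`|r|^-1 *: r) :: es); split.
- rewrite /= po andbT; apply/allP => w /r_ortho rw.
  by rewrite innerZl rw mulr0.
- by rewrite /= un andbT innerZl innerZr -inner_norm expr2 mulKf// mulVf.
- move=> x; rewrite inE big_cons innerZr scalerA => /predU1P[->|xs].
    have yr : inner y r = `|r| ^+ 2.
      rewrite -[y](subrK (\sum_(v <- es) inner y v *: v)) -/r innerDl -inner_norm.
      rewrite inner_suml big1_seq ?addr0// => v /andP[_ ves].
      by rewrite innerZl (innerC v) r_ortho// mulr0.
    rewrite yr expr2 mulKf// mulfV// scale1r.
    by rewrite /r subrK.
  have -> : inner x r = 0.
    rewrite (sp _ xs) inner_suml big1_seq// => v /andP[_ ves].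
    by rewrite innerZl (innerC v) r_ortho// mulr0.
  by rewrite mulr0 mul0r scale0r add0r; exact: sp.
Qed.

Lemma orthonormal_basis : finite_dimensional X -> exists (n : nat) (e : 'I_n -> X),
  (forall i j, inner (e j) (e i) = (i == j)%:R) /\
  forall x, x = \sum_i inner x (e i) *: e i.
Proof.
move=> [m [b bP]]; have [es [po un sp]] := orthonormal_seq [seq b i | i <- enum 'I_m].
exists (size es), (fun i => nth 0 es i); split.
  move=> i j; have [->|ij] := eqVneq i j.
    by rewrite (eqP (allP un _ (mem_nth _ _))).
  have pw := pairwiseP 0 po.
  have [h|h|h] := ltngtP i j; last by move: ij; rewrite (val_inj h) eqxx.
    by rewrite innerC (eqP (pw _ _ _ _ h)) ?inE.
  by rewrite (eqP (pw _ _ _ _ h)) ?inE.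
move=> x; rewrite -(big_mkord xpredT (fun i => inner x (nth 0 es i) *: nth 0 es i)).
rewrite -(big_nth 0 xpredT (fun v => inner x v *: v)).
have [c xc] := bP x; rewrite [LHS]xc.
transitivity (\sum_(i < m) \sum_(v <- es) (c i * inner (b i) v) *: v).
  apply: eq_bigr => i _; rewrite {1}(sp (b i)) ?map_f ?mem_enum// scaler_sumr.
  by apply: eq_bigr => v _; rewrite scalerA.
rewrite exchange_big/=; apply: eq_bigr => v _.
by rewrite xc inner_suml scaler_suml; apply: eq_bigr => i _; rewrite innerZl.
Qed.

(** The ball is a closed subset of the continuous image of the cube of coordinates in [-r, r]. *)
Lemma finite_dimensional_compact : finite_dimensional X ->
  forall (z : X) (r : R), compact [set x | `|x - z| <= r].
Proof.
move=> /orthonormal_basis[n [e [ee esp]]] z r.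
pose B := [set v : 'rV[R]_n | forall i, `[- r, r]%classic (v ord0 i)].
have cB : compact B.
  by apply: (@rV_compact _ n (fun=> `[- r, r]%classic)) => i; exact: segment_compact.
pose f (v : 'rV[R]_n) : X := z + \sum_i v ord0 i *: e i.
have cs : continuous (fun v : 'rV[R]_n => \sum_i v ord0 i *: e i).
  apply: (@continuous_big _ _ +%R) => [|i _ v].
    exact: add_continuous.
  have h := @coord_continuous R 1 n ord0 i v.
  exact: (cvgZr_tmp (a := e i) h).
have cf : continuous f.
  by move=> v; exact: (cvgD (cvg_cst z) (cs v)).
have cfB : compact (f @` B).
  by apply: continuous_compact => //; exact: continuous_subspaceT.
apply: subclosed_compact cfB _.
  have -> : [set x | `|x - z| <= r] = (fun x => `|x - z|) @^-1` [set y | y <= r] by [].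
  apply: closed_comp; last exact: closed_le.
  by move=> x _; apply: cvg_norm; apply: cvgB; [exact: cvg_id|exact: cvg_cst].
move=> x /= xr; exists (\row_i inner (x - z) (e i)); last first.
  rewrite /f; under eq_bigr => i _ do rewrite mxE.
  by rewrite -esp addrC subrK.
move=> i /=; rewrite in_itv/= mxE -ler_norml (le_trans _ xr)// inner_le_unit//.
by apply/eqP; rewrite -(@eqrXn2 _ 2) ?expr1n ?inner_norm ?ee ?eqxx.
Qed.

End InnerProduct.

(** * Cones and limits of sets in terms of epsilons *)

Section ConesEpsilon.
Variables (R : realType) (X Y : normedModType R).
Implicit Types (M U : set (X * Y)) (p q : X * Y) (r t : R).

Definition pair_within p q r := `|q.1 - p.1| < r /\ `|q.2 - p.2| < r.

Lemma nbhs_pairP p U :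
  nbhs p U <-> exists2 r, 0 < r & forall q, pair_within p q r -> U q.
Proof.
split=> [/nbhs_ballP[r /= r0 rU]|[r r0 rU]].
  exists r => // q [q1 q2]; apply: rU; split; rewrite -ball_normE/= distrC//.
apply/nbhs_ballP; exists r => // q [q1 q2]; apply: rU; split; rewrite distrC.
  by move: q1; rewrite -ball_normE.
by move: q2; rewrite -ball_normE.
Qed.

Lemma at_right0P (A : set R) :
  0^'+ A <-> exists2 tau, 0 < tau & forall t, 0 < t -> t < tau -> A t.
Proof.
split=> [|[tau tau0 tA]].
  rewrite /at_right/within/= => /nbhs_normP[tau /= tau0 tA]; exists tau => // t t0 tt.
  by apply: tA => //=; rewrite sub0r normrN gtr0_norm.
rewrite /at_right/within/=; apply/nbhs_normP; exists tau => //= t /=.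
by rewrite sub0r normrN => tt t0; apply: tA => //; rewrite gtr0_norm in tt.
Qed.

(** The relation common to the four cones, which differ only in the quantification of t and p. *)
Definition hits M t p q r := exists2 p', M p' &
  pair_within q (t^-1 *: (p' - p)) r.

Lemma pair_within_le p q r r' : r <= r' -> pair_within p q r -> pair_within p q r'.
Proof. by move=> rr [q1 q2]; split; exact: lt_le_trans rr. Qed.

Let pk_limsupP (T : Type) (F : set_system T) (S : T -> set (X * Y)) q :
  pk_limsup F S q <-> forall (A : set T) r, F A -> 0 < r ->
    exists2 t, A t & exists2 q', S t q' & pair_within q q' r.
Proof.
split=> [h A r FA r0|h A U FA /nbhs_pairP[r r0 rU]].
  have [|t At [q' [Sq' qq']]] := h A [set q' | pair_within q q' r] FA.
    by apply/nbhs_pairP; exists r.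
  by exists t => //; exists q'.
by have [t At [q' Sq' /rU Uq']] := h A r FA r0; exists t => //; exists q'.
Qed.

Let pk_liminfP (T : Type) (F : set_system T) (S : T -> set (X * Y)) q : Filter F ->
  pk_liminf F S q <-> forall r, 0 < r ->
    \forall t \near F, exists2 q', S t q' & pair_within q q' r.
Proof.
move=> FF; split=> [h r r0|h U /nbhs_pairP[r r0 rU]].
  have := h [set q' | pair_within q q' r].
  have nq : nbhs q [set q' | pair_within q q' r] by apply/nbhs_pairP; exists r.
  by move=> /(_ nq); apply: filterS => t [q' [Sq' qq']]; exists q'.
by apply: filterS (h r r0) => t [q' Sq' /rU Uq']; exists q'.
Qed.

Let hitsP M t p q r : hits M t p q r <->
  exists2 q', diff_quotient M p t q' & pair_within q q' r.
Proof.
split=> [[p' Mp' h]|[_ [p' Mp' <-] h]]; last by exists p'.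
by exists (t^-1 *: (p' - p)) => //; exists p'.
Qed.

Lemma tangent_coneP M p q : tangent_cone M p q <->
  forall r tau, 0 < r -> 0 < tau -> exists t, [/\ 0 < t, t < tau & hits M t p q r].
Proof.
split=> [/pk_limsupP h r tau r0 tau0|h]; last first.
  apply/pk_limsupP => A r /at_right0P[tau tau0 tA] r0.
  by have [t [t0 tt /hitsP m]] := h r tau r0 tau0; exists t => //; exact: tA.
have [|//|t [t0 tt] /hitsP m] := h [set t | 0 < t /\ t < tau] r; last by exists t.
by apply/at_right0P; exists tau.
Qed.

Lemma derivable_coneP M p q : derivable_cone M p q <->
  forall r, 0 < r -> exists2 tau, 0 < tau & forall t, 0 < t -> t < tau -> hits M t p q r.
Proof.
split=> [/pk_liminfP h r r0|h].
  have /at_right0P[tau tau0 tA] := h r r0.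
  by exists tau => // t t0 tt; apply/hitsP; exact: tA.
apply/pk_liminfP => r r0; apply/at_right0P; have [tau tau0 tA] := h r r0.
by exists tau => // t t0 tt; apply/hitsP; exact: tA.
Qed.

Lemma within_nbhs_pairP M p (A : set (X * Y)) : within M (nbhs p) A <->
  exists2 r, 0 < r & forall q, M q -> pair_within p q r -> A q.
Proof.
split=> [/nbhs_pairP[r r0 h]|[r r0 h]]; first by exists r => // q Mq /h; exact.
by apply/nbhs_pairP; exists r => // q /h pq Mq; exact: pq.
Qed.

Let prod_filterP M p (S : set ((X * Y) * R)) :
  filter_prod (within M (nbhs p)) 0^'+ S <-> exists2 tau, 0 < tau &
    forall p' t, M p' -> pair_within p p' tau -> 0 < t -> t < tau -> S (p', t).
Proof.
split=> [[[A B] /= [/within_nbhs_pairP[r r0 rA] /at_right0P[tau tau0 tB]] AB]|[tau tau0 h]].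
  exists (Num.min r tau); first by rewrite lt_min r0.
  move=> p' t Mp' pp' t0; rewrite lt_min => /andP[_ tt]; apply: AB; split => /=.
    by apply: rA => //; apply: pair_within_le pp'; rewrite ge_min lexx.
  exact: tB.
exists ([set p' | M p' /\ pair_within p p' tau], [set t | 0 < t /\ t < tau]) => /=.
  split; first by apply/within_nbhs_pairP; exists tau.
  by apply/at_right0P; exists tau.
by move=> [p' t] /= [[Mp' pp'] [t0 tt]]; exact: h.
Qed.

Lemma regular_tangent_coneP M p q : regular_tangent_cone M p q <->
  forall r, 0 < r -> exists2 tau, 0 < tau & forall p' t,
    M p' -> pair_within p p' tau -> 0 < t -> t < tau -> hits M t p' q r.
Proof.
split=> [/pk_liminfP h r r0|h].
  have /prod_filterP[tau tau0 tA] := h r r0.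
  by exists tau => // p' t Mp' pp' t0 tt; apply/hitsP; exact: tA.
apply/pk_liminfP => r r0; apply/prod_filterP; have [tau tau0 tA] := h r r0.
by exists tau => // p' t Mp' pp' t0 tt; apply/hitsP; exact: tA.
Qed.

Lemma paratingent_coneP M p q : paratingent_cone M p q <->
  forall r tau, 0 < r -> 0 < tau -> exists p' t,
    [/\ M p', pair_within p p' tau, 0 < t, t < tau & hits M t p' q r].
Proof.
split=> [/pk_limsupP h r tau r0 tau0|h]; last first.
  apply/pk_limsupP => A r /prod_filterP[tau tau0 tA] r0.
  have [p' [t [Mp' pp' t0 tt /hitsP m]]] := h r tau r0 tau0.
  by exists (p', t) => //; exact: tA.
have [|//|[p' t] /= [Mp' pp' t0 tt] /hitsP m] := h [set pt : (X * Y) * R |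
  [/\ M pt.1, pair_within p pt.1 tau, 0 < pt.2 & pt.2 < tau]] r; last by exists p', t.
by apply/prod_filterP; exists tau.
Qed.

(** It is enough that the outer limit lies in C and C in the inner limit, since the inner limit lies
    in the outer one. This last inclusion is where M has to meet every neighbourhood of p: along an
    improper filter the inner limit is everything and the outer limit is empty. *)
Lemma pk_converges_withinP M p (S : X * Y -> set (X * Y)) (C : set (X * Y)) :
  (forall tau, 0 < tau -> exists2 p', M p' & pair_within p p' tau) ->
  pk_converges (within M (nbhs p)) S C <->
  (forall q, (forall r tau, 0 < r -> 0 < tau -> exists p',
      [/\ M p', pair_within p p' tau & exists2 q', S p' q' & pair_within q q' r]) -> C q) /\
  (forall q, C q -> forall r, 0 < r -> exists2 tau, 0 < tau & forall p', M p' ->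
      pair_within p p' tau -> exists2 q', S p' q' & pair_within q q' r).
Proof.
move=> clM; split=> [[supC infC]|[h1 h2]].
  split=> q; last first.
    rewrite -infC => /pk_liminfP h r r0.
    by have /within_nbhs_pairP[tau tau0 h'] := h r r0; exists tau.
  move=> h; rewrite -supC; apply/pk_limsupP => A r /within_nbhs_pairP[tau tau0 tA] r0.
  by have [p' [Mp' pp' qq]] := h r tau r0 tau0; exists p' => //; exact: tA.
have C_inf : C `<=` pk_liminf (within M (nbhs p)) S.
  move=> q Cq; apply/pk_liminfP => r r0; apply/within_nbhs_pairP.
  by have [tau tau0 h] := h2 q Cq r r0; exists tau.
have inf_sup : pk_liminf (within M (nbhs p)) S `<=` pk_limsup (within M (nbhs p)) S.
  move=> q /pk_liminfP h; apply/pk_limsupP => A r /within_nbhs_pairP[tau tau0 tA] r0.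
  have /within_nbhs_pairP[tau' tau'0 h'] := h r r0.
  have [|p' Mp' pp'] := clM (Num.min tau tau'); first by rewrite lt_min tau0.
  exists p'.
    by apply: tA => //; apply: pair_within_le pp'; rewrite ge_min lexx.
  by apply: h' => //; apply: pair_within_le pp'; rewrite ge_min lexx orbT.
have sup_C : pk_limsup (within M (nbhs p)) S `<=` C.
  move=> q /pk_limsupP h; apply: h1 => r tau r0 tau0.
  have [|//|p' [Mp' pp'] qq] := h [set p' | M p' /\ pair_within p p' tau] r; last by exists p'.
  by apply/within_nbhs_pairP; exists tau.
split; apply/seteqP; split => //.
- exact: subset_trans C_inf inf_sup.
- exact: subset_trans inf_sup sup_C.
Qed.

End ConesEpsilon.

(** * Lipschitz mappings in finite dimension *)

Section LipschitzExtension.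
Variables (R : realType) (X : normedModType R).

Lemma mcshane_extension (B : set X) (g : X -> R) (L : R) : 0 <= L ->
  (forall x y, B x -> B y -> `|g x - g y| <= L * `|x - y|) ->
  exists2 h, klip L h & forall x, B x -> h x = g x.
Proof.
move=> L0 gL; have [->|/set0P[y0 By0]] := eqVneq B set0.
  by exists (fun=> 0) => // x y; rewrite subrr normr0 mulr_ge0.
pose S x := [set g y + L * `|x - y| | y in B].
have S0 x : S x !=set0 by exists (g y0 + L * `|x - y0|); exists y0.
have lbS x z : B z -> lbound (S x) (g z - L * `|x - z|).
  move=> Bz _ [y By <-]; have := gL _ _ Bz By; rewrite ler_norml => /andP[_ h1].
  have : L * `|z - y| <= L * (`|x - z| + `|x - y|).
    rewrite ler_wpM2l// [`|x - z|]distrC.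
    by have := ler_normD (z - x) (x - y); rewrite addrA subrK.
  lra.
have hS x : has_lbound (S x) by exists (g y0 - L * `|x - y0|); exact: lbS.
have h1 x y : inf (S x) - inf (S y) <= L * `|x - y|.
  rewrite lerBlDl -lerBlDr; apply: lb_le_inf => // _ [z Bz <-]; rewrite lerBlDr.
  apply: (@le_trans _ _ (g z + L * `|x - z|)); first by apply: ge_inf => //; exists z.
  rewrite -addrA lerD2l -mulrDr ler_wpM2l// [leRHS]addrC.
  by have := ler_normD (x - y) (y - z); rewrite addrA subrK.
exists (fun x => inf (S x)).
  by move=> x y; rewrite ler_norml h1 andbT lerNl opprB distrC h1.
move=> x Bx; apply/eqP; rewrite eq_le; apply/andP; split.
  by apply: ge_inf => //; exists x => //; rewrite subrr normr0 mulr0 addr0.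
apply: lb_le_inf => //; have := lbS x x Bx.
by rewrite subrr normr0 mulr0 subr0.
Qed.

End LipschitzExtension.

(** * Vector-valued Lipschitz mappings in orthonormal coordinates *)

Section OrthonormalCoordinates.
Variables (R : realType) (X : normedModType R) (inner : {dot X for idfun}).
Hypothesis inner_norm : forall x : X, `|x| ^+ 2 = inner x x.
Variables (n : nat) (e : 'I_n -> X).
Hypothesis e_ortho : forall i j, inner (e j) (e i) = (i == j)%:R.
Hypothesis e_span : forall x, x = \sum_i inner x (e i) *: e i.
Local Notation mu := (@lebesgue_measure R).

Let e1 i : `|e i| = 1.
Proof. by apply/eqP; rewrite -(@eqrXn2 _ 2)// expr1n inner_norm// e_ortho eqxx. Qed.

Lemma norm_le_coord x (k : R) : (forall i, `|inner x (e i)| <= k) -> `|x| <= n%:R * k.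
Proof.
move=> xk; rewrite [x in `|x|]e_span (le_trans (ler_norm_sum _ _ _))//.
apply: (@le_trans _ _ (\sum_(i < n) k)).
  by apply: ler_sum => i _; rewrite normrZ e1 mulr1.
by rewrite sumr_const card_ord mulr_natl.
Qed.

(** Each coordinate is extended separately. The factor n lost in the constant is harmless, as only
    some global Lipschitz constant matters later. *)
Lemma lipschitz_vector_extension (B : set X) (P : X -> X) (L : R) : 0 <= L ->
  (forall x y, B x -> B y -> `|P x - P y| <= L * `|x - y|) ->
  exists2 Q : X -> X, (forall x y, `|Q x - Q y| <= n%:R * L * `|x - y|) &
    forall x, B x -> Q x = P x.
Proof.
move=> L0 PL.
have /choice[h hP] : forall i, exists h : X -> R, klip L h /\
    forall x, B x -> h x = inner (P x) (e i).
  move=> i; have [|h h1 h2] := @mcshane_extension _ _ B (fun x => inner (P x) (e i)) L L0.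
    move=> x y Bx By; rewrite -(innerBl inner).
    exact: le_trans (inner_le_unit inner_norm _ (e1 i)) (PL _ _ Bx By).
  by exists h.
have hE x i : inner (\sum_j h j x *: e j) (e i) = h i x.
  rewrite inner_suml (bigD1 i)//= innerZl e_ortho eqxx mulr1 big1 ?addr0// => j ji.
  by rewrite innerZl e_ortho eq_sym (negPf ji) mulr0.
exists (fun x => \sum_i h i x *: e i).
  move=> x y; rewrite -mulrA; apply: norm_le_coord => i.
  by rewrite innerBl !hE; have [hl _] := hP i; exact: hl.
move=> x Bx; rewrite [RHS]e_span; apply: eq_bigr => i _.
by have [_ ->] := hP i.
Qed.

Definition vecslope (P : X -> X) u w d := forall eta, 0 < eta ->
  exists2 tau, 0 < tau & forall t, `|t| < tau ->
    `|P (u + t *: w) - P u - t *: d| <= eta * `|t|.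

Definition gateaux (P : X -> X) u := exists2 A : X -> X,
  forall (a : R) v w, A (a *: v + w) = a *: A v + A w &
  forall w, vecslope P u w (A w).

Lemma lnull_not_gateaux_vector (P : X -> X) (L : R) :
  (forall x y, `|P x - P y| <= L * `|x - y|) -> lnull e [set u | ~ gateaux P u].
Proof.
move=> PL.
pose N i := [set x | ~ exists2 l : X -> R, forall (a : R) u v, l (a *: u + v) = a * l u + l v &
                     forall w, dirslope (fun u => inner (P u) (e i)) w x (l w)].
apply: (@lnull_sub _ _ _ e _ (\bigcup_i N i)); last first.
  apply: lnull_bigcup => i; apply: (@lnull_not_gateaux _ _ _ e (fun i x => inner x (e i)) _ _ _ _ _ _ L).
  - by move=> j a u v; rewrite innerDl innerZl.
  - by move=> j x; exact: inner_le_unit.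
  - by move=> j k; exact: e_ortho.
  - by move=> j; rewrite e1.
  - exact: e_span.
  - move=> x y; rewrite -innerBl; exact: le_trans (inner_le_unit inner_norm _ (e1 i)) (PL _ _).
move=> x /= ngx; apply: contrapT => Nx; apply: ngx.
have /choice[l lP] : forall i, exists l : X -> R,
   (forall (a : R) u v, l (a *: u + v) = a * l u + l v) /\
   forall w, dirslope (fun u => inner (P u) (e i)) w x (l w).
  move=> i; have /contrapT[l l1 l2] : ~ N i x by move=> Nix; apply: Nx; exists i.
  by exists l.
have lE w i : inner (\sum_j l j w *: e j) (e i) = l i w.
  rewrite inner_suml (bigD1 i)//= innerZl e_ortho eqxx mulr1 big1 ?addr0// => j ji.
  by rewrite innerZl e_ortho eq_sym (negPf ji) mulr0.
exists (fun w => \sum_i l i w *: e i).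
  move=> a v w; rewrite scaler_sumr -big_split/=; apply: eq_bigr => i _.
  by have [-> _] := lP i; rewrite scalerDl scalerA.
move=> w eta eta0.
(* The norm is at most n times the largest coordinate; n + 1 keeps the quotient meaningful for n =
   0, as does the default 1 of the minimum below. *)
have en0 : 0 < eta / (n%:R + 1) by rewrite divr_gt0// ltr_pwDr.
have /choice[tau tauP] : forall i, exists tau : R, 0 < tau /\ forall t, `|t| < tau ->
   `|inner (P (x + t *: w)) (e i) - inner (P x) (e i) - l i w * t| <= eta / (n%:R + 1) * `|t|.
  by move=> i; have [_ /(_ w _ en0)[tau tau0 h]] := lP i; exists tau.
exists (\big[Num.min/1]_i tau i).
  by apply: lt_bigmin => // i _; have [] := tauP i.
move=> t tt; apply: (@le_trans _ _ (n%:R * (eta / (n%:R + 1) * `|t|))).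
  apply: norm_le_coord => i; rewrite !innerBl innerZl lE mulrC.
  have [_] := tauP i; apply; apply: lt_le_trans tt _; exact: bigmin_le.
rewrite mulrA ler_wpM2r// mulrCA ler_piMr ?(ltW eta0)//.
by rewrite ler_pdivrMr ?ltr_pwDr// mul1r lerDl.
Qed.

(* Almost every point of a generic line parallel to w is a point of Gateaux
   differentiability; the inequality holds on such lines and passes to the limit. *)
Lemma vecslope_mean_value (P : X -> X) (L : R) (z : X) (w y : X) (kappa tau : R) :
  0 <= kappa -> 0 <= L ->
  (forall x y, `|P x - P y| <= L * `|x - y|) ->
  (forall u, `|u - z| < tau -> gateaux P u -> exists2 d, vecslope P u w d & `|d - y| <= kappa) ->
  forall u t, 0 < t -> `|u - z| + t * `|w| < tau ->
    `|P (u + t *: w) - P u - t *: y| <= kappa * t.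
Proof.
move=> kappa0 L0 PL H u t t0 ut; pose b := P (u + t *: w) - P u - t *: y.
have [b0|b0] := eqVneq b 0; first by rewrite -/b b0 normr0 mulr_ge0// ltW.
have bp : 0 < `|b| by rewrite normr_gt0.
apply/ler_addgt0Pr => eps eps0.
(* The first bound limits the cost of replacing u by v to eps |b|; the second keeps the translated
   segment within tau of z. *)
pose r := Num.min (eps / (2 * (L + 1))) (tau - (`|u - z| + t * `|w|)).
have L1 : 0 < L + 1 by rewrite ltr_pwDr.
have r0 : 0 < r by rewrite lt_min divr_gt0 ?mulr_gt0//= subr_gt0.
have [v vu nv] := lnull_avoid w u (lnull_not_gateaux_vector PL) r0.
(* Pairing with the error b itself reduces the vector estimate to the scalar mean value
   inequality. *)
pose phi s := inner (P (v + s *: w) - s *: y) b.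
have mv : phi t - phi 0 <= kappa * `|b| * (t - 0).
  apply: (@lipschitz_mean_value _ phi ((L * `|w| + `|y|) * `|b|)) => //.
    move=> s s'; rewrite /phi -innerBl (le_trans (inner_cauchy inner_norm _ _))//.
    rewrite mulrAC ler_wpM2r//.
    have -> : P (v + s *: w) - s *: y - (P (v + s' *: w) - s' *: y) =
      (P (v + s *: w) - P (v + s' *: w)) - (s - s') *: y.
      by rewrite scalerBl !opprB addrACA [RHS]addrACA; congr (_ + _); rewrite addrC.
    rewrite (le_trans (ler_normB _ _))// normrZ mulrDl mulrC [`|y| * _]mulrC lerD2r.
    rewrite (le_trans (PL _ _))// opprD addrACA subrr add0r -scalerBl normrZ.
    by rewrite mulrCA mulrC.
  apply: negligibleS nv => s /= + gs; apply => /andP[s0 st].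
  have [|d ds dy] := H (v + s *: w) _ gs.
    rewrite addrAC (le_lt_trans (ler_normD _ _))// normrZ (gtr0_norm s0).
    have : s * `|w| <= t * `|w| by rewrite ler_wpM2r// ltW.
    have := ler_normD (v - u) (u - z); rewrite addrA subrK.
    move: vu; rewrite /r lt_min => /andP[_]; lra.
  exists (inner (d - y) b).
    by rewrite (le_trans (ler_norm _))// (le_trans (inner_cauchy inner_norm _ _))// ler_wpM2r.
  move=> eta eta0; have [tau' tau'0 D] := ds (eta / `|b|) (divr_gt0 eta0 bp).
  exists tau' => // h /D hD.
  have -> : phi (s + h) - phi s - inner (d - y) b * h =
     inner (P (v + s *: w + h *: w) - P (v + s *: w) - h *: d) b.
    rewrite /phi scalerDl addrA [_ * h]mulrC !innerBl !innerZl.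
    by ring.
  rewrite (le_trans (inner_cauchy inner_norm _ _))// -ler_pdivlMr//.
  by rewrite mulrAC.
have key : inner b b - 2 * L * r * `|b| <= phi t - phi 0.
  pose b' := P (v + t *: w) - P v - t *: y.
  have -> : phi t - phi 0 = inner b' b.
    by rewrite /phi /b' scale0r addr0 scale0r subr0 !innerBl !innerZl; ring.
  have bb' : `|b - b'| <= 2 * L * r.
    have -> : b - b' = (P (u + t *: w) - P (v + t *: w)) - (P u - P v).
      by rewrite /b /b' [in LHS]opprB addrA subrK !opprB addrACA [RHS]addrACA; congr (_ + _); rewrite addrC.
    rewrite (le_trans (ler_normB _ _))//.
    have uv : `|u - v| <= r by rewrite distrC ltW.
    have h1 := PL u v; have h2 := PL (u + t *: w) (v + t *: w).
    have {}h2 : `|P (u + t *: w) - P (v + t *: w)| <= L * `|u - v|.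
      by rewrite (le_trans h2)// opprD addrACA subrr addr0.
    have : L * `|u - v| <= L * r by rewrite ler_wpM2l.
    lra.
  rewrite lerBlDl -lerBlDr -innerBl (le_trans (ler_norm _))//.
  by rewrite (le_trans (inner_cauchy inner_norm _ _))// ler_wpM2r.
have : `|b| * `|b| <= (kappa * t + eps) * `|b|.
  rewrite -expr2 inner_norm.
  have : 2 * L * r * `|b| <= eps * `|b|.
    rewrite ler_wpM2r//; have : r <= eps / (2 * (L + 1)) by rewrite /r ge_min lexx.
    rewrite ler_pdivlMr ?mulr_gt0//; have := ltW r0; lra.
  by move: mv; rewrite subr0; lra.
by rewrite ler_pM2r.
Qed.

End OrthonormalCoordinates.

(** * Tangent cones to Lipschitz graphs *)

Section LipschitzGraph.
Variables (R : realType) (X : normedModType R).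
Variables (P : X -> X) (L : R).
Hypothesis L0 : 0 <= L.
Hypothesis P_lip : forall u v, `|P u - P v| <= L * `|u - v|.
Implicit Types (u v w x y z : X) (r t eta tau : R).

Definition incr_err u t w y := `|P (u + t *: w) - P u - t *: y|.

Lemma incr_err_close u t w w' y y' eta eta' : 0 < t ->
  incr_err u t w y < eta * t -> incr_err u t w' y' < eta' * t ->
  `|y - y'| < eta + eta' + L * `|w - w'|.
Proof.
move=> t0 h h'; rewrite -(ltr_pM2l t0) -[t in t * `|_|](gtr0_norm t0) -normrZ.
have -> : t *: (y - y') = (P (u + t *: w') - P u - t *: y') -
   (P (u + t *: w) - P u - t *: y) + (P (u + t *: w) - P (u + t *: w')).
  have -> : P (u + t *: w) - P (u + t *: w') =
      (P (u + t *: w) - P u) - (P (u + t *: w') - P u) by rewrite opprB addrA subrK.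
  rewrite scalerBr [in RHS]opprB -[RHS]addrA (addrA (t *: y - _)) subrK.
  by rewrite [RHS]addrC addrA subrK.
have := ler_normD ((P (u + t *: w') - P u - t *: y') -
   (P (u + t *: w) - P u - t *: y)) (P (u + t *: w) - P (u + t *: w')).
have := ler_normB (P (u + t *: w') - P u - t *: y') (P (u + t *: w) - P u - t *: y).
have : `|P (u + t *: w) - P (u + t *: w')| <= t * (L * `|w - w'|).
  rewrite (le_trans (P_lip _ _))// opprD addrACA subrr add0r -scalerBr normrZ.
  by rewrite (gtr0_norm t0) mulrCA.
move: h h'; rewrite /incr_err; lra.
Qed.

(** Membership in the tangent and the derivable cone, seen from P: y is a cluster value,
    respectively the limit, of the difference quotients. *)
Definition tanP u w y := forall eta tau, 0 < eta -> 0 < tau ->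
  exists t, [/\ 0 < t, t < tau & incr_err u t w y < eta * t].
Definition derP u w y := forall eta, 0 < eta -> exists2 tau, 0 < tau &
  forall t, 0 < t -> t < tau -> incr_err u t w y < eta * t.

Lemma derP_tanP u w y : derP u w y -> tanP u w y.
Proof.
move=> h eta tau eta0 tau0; have [tau' tau'0 h'] := h _ eta0.
have m0 : 0 < Num.min tau tau' by rewrite lt_min tau0.
have : Num.min tau tau' / 2 < Num.min tau tau' by rewrite ltr_pdivrMr// ltr_pMr// ltr1n.
have t0 : 0 < Num.min tau tau' / 2 by rewrite divr_gt0.
by rewrite lt_min => /andP[t1 t2]; exists (Num.min tau tau' / 2); split => //; exact: h'.
Qed.

Lemma tanP_derP_close u w w' y y' : tanP u w y -> derP u w' y' ->
  `|y - y'| <= L * `|w - w'|.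
Proof.
move=> h h'; apply/ler_addgt0Pr => eps eps0; have e2 : 0 < eps / 2 by rewrite divr_gt0.
have [tau tau0 D'] := h' _ e2; have [t [t0 tt D]] := h _ _ e2 tau0.
have := incr_err_close t0 D (D' t t0 tt); lra.
Qed.

Hypothesis cpt : forall z r, compact [set x : X | `|x - z| <= r].

(** The difference quotients stay in a compact ball. Hence every direction w comes from some tangent
    vector (y, z) with y + lam z = w. *)
Lemma tanP_exists u w : exists2 y, tanP u w y & `|y| <= L * `|w|.
Proof.
pose q t := t^-1 *: (P (u + t *: w) - P u).
have qL t : 0 < t -> `|q t - 0| <= L * `|w|.
  move=> t0; rewrite subr0 normrZ gtr0_norm ?invr_gt0// ler_pdivrMl//.
  by rewrite (le_trans (P_lip _ _))// addrAC subrr add0r normrZ gtr0_norm// mulrCA.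
have Fq : (q @ 0^'+) [set x : X | `|x - 0| <= L * `|w|].
  by apply/at_right0P; exists 1 => // t t0 _; exact: qL.
have [y [/= yL ycl]] := @cpt 0 (L * `|w|) (q @ 0^'+) (fmap_proper_filter q _) Fq.
exists y; last by rewrite subr0 in yL.
move=> eta tau eta0 tau0.
have [||_ [[t [t0 tt] <-] /=]] := ycl (q @` [set t | 0 < t /\ t < tau]) (ball y eta).
- apply/at_right0P; exists tau => // t t0 tt; exists t => //.
- exact: nbhsx_ballx.
rewrite -ball_normE/= distrC => qy; exists t; split => //.
rewrite /incr_err mulrC -ltr_pdivrMl// -[t^-1](gtr0_norm (_ : 0 < t^-1)) ?invr_gt0// -normrZ.
by rewrite scalerBr scalerA mulVf ?gt_eqF// scale1r.
Qed.

Lemma vecslope_derP u w y : vecslope P u w y -> derP u w y.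
Proof.
move=> h eta eta0; have e2 : 0 < eta / 2 by rewrite divr_gt0.
have [tau tau0 D] := h _ e2; exists tau => // t t0 tt.
have := D t; rewrite gtr0_norm// => /(_ tt) /le_lt_trans; apply.
by rewrite ltr_pM2r// ltr_pdivrMr// ltr_pMr// ltr1n.
Qed.

End LipschitzGraph.

(** * Cones of a set parametrized near a point by a Lipschitz mapping *)

Section GraphCones.
Variables (R : realType) (X : normedModType R) (inner : {dot X for idfun}).
Hypothesis inner_norm : forall x : X, `|x| ^+ 2 = inner x x.
Hypothesis fin_dim : finite_dimensional X.
Variables (P : X -> X) (L : R).
Hypothesis L0 : 0 <= L.
Hypothesis P_lip : forall u v, `|P u - P v| <= L * `|u - v|.
Variables (M : set (X * X)) (lam : R) (ubar : X).
Hypothesis lam0 : 0 < lam.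
Implicit Types (u v w x y z : X) (p q : X * X) (r t eta tau : R).

Definition param u : X * X := (P u, lam^-1 *: (u - P u)).
Local Notation G := param.

(** The second condition amounts to p = G (p.1 + lam p.2), so together they say that M and the image
    of G agree near G ubar. *)
Hypothesis param_in : exists2 del, 0 < del & forall u, `|u - ubar| < del -> M (G u).
Hypothesis param_onto : exists2 rho, 0 < rho & forall p, M p -> pair_within (G ubar) p rho ->
  P (p.1 + lam *: p.2) = p.1.

Lemma param_lip u v r : (1 + L) * (1 + lam^-1) * `|v - u| < r -> pair_within (G u) (G v) r.
Proof.
have il0 : 0 < lam^-1 by rewrite invr_gt0.
rewrite /pair_within /=; set il := lam^-1 in il0 *.
have := P_lip v u; have := normr_ge0 (v - u); set d := `|v - u| => d0 Pd.
have Ld : 0 <= L * d by rewrite mulr_ge0.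
have ild : 0 <= il * d by rewrite mulr_ge0// ltW.
have ilLd : 0 <= il * (L * d) by rewrite mulr_ge0// ltW.
move=> hr; split; first by apply: le_lt_trans hr; lra.
apply: le_lt_trans hr; rewrite -scalerBr normrZ gtr0_norm//.
have -> : v - P v - (u - P u) = (v - u) - (P v - P u).
  by rewrite !opprB addrACA [RHS]addrACA; congr (_ + _); rewrite addrC.
have := ler_normB (v - u) (P v - P u); rewrite -/d => h.
have : il * `|v - u - (P v - P u)| <= il * (d + L * d).
  by apply: ler_wpM2l; [exact: ltW|lra].
lra.
Qed.

Lemma near_param tau : 0 < tau -> exists2 d, 0 < d &
  forall u, `|u - ubar| < d -> pair_within (G ubar) (G u) tau.
Proof.
move=> tau0; have C0 : 0 < (1 + L) * (1 + lam^-1).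
  by rewrite mulr_gt0// ltr_pwDl ?invr_ge0// ltW.
exists (tau / ((1 + L) * (1 + lam^-1))); first by rewrite divr_gt0.
by move=> u hu; apply: param_lip; rewrite mulrC -ltr_pdivlMr.
Qed.

Lemma param_sum u : (G u).1 + lam *: (G u).2 = u.
Proof. by rewrite /= scalerA mulfV ?gt_eqF// scale1r addrC subrK. Qed.

Lemma pair_within_sum p q r : pair_within p q r ->
  `|q.1 + lam *: q.2 - (p.1 + lam *: p.2)| < (1 + lam) * r.
Proof.
move=> [h1 h2]; rewrite opprD addrACA -scalerBr.
rewrite (le_lt_trans (ler_normD _ _))// normrZ gtr0_norm// mulrDl mul1r.
by rewrite ltrD// ltr_pM2l.
Qed.

Lemma near_is_param tau : 0 < tau -> exists2 r, 0 < r &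
  forall p, M p -> pair_within (G ubar) p r -> exists2 u, `|u - ubar| < tau & p = G u.
Proof.
move=> tau0; have [rho rho0 onto] := param_onto.
have l1 : 0 < 1 + lam by rewrite ltr_pwDl// ltW.
exists (Num.min rho (tau / (1 + lam))); first by rewrite lt_min rho0 divr_gt0.
move=> p Mp pn; exists (p.1 + lam *: p.2).
  have := pair_within_sum pn; rewrite param_sum => /lt_le_trans; apply.
  by rewrite mulrC -ler_pdivlMr// ge_min lexx orbT.
have Pp : P (p.1 + lam *: p.2) = p.1.
  by apply: onto => //; apply: pair_within_le pn; rewrite ge_min lexx.
rewrite /G Pp addrAC subrr add0r scalerA mulVf ?gt_eqF// scale1r.
by rewrite -surjective_pairing.
Qed.

(** C1: an error eta in the quotient of P gives errors eta and eta / lam in the two components. C2: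
    conversely, errors eta in both components displace u by (1 + lam) eta t, hence P by L times as
    much, on top of eta t. *)
Let C1 := 1 + lam^-1.
Let C2 := 1 + L * (1 + lam).
Let C10 : 0 < C1. Proof. by rewrite ltr_pwDl// invr_ge0 ltW. Qed.
Let C20 : 0 < C2. Proof. by rewrite ltr_pwDl// mulr_ge0// ltW// ltr_pwDl// ltW. Qed.

Let quot_normB (a b y : X) t r : 0 < t -> `|t^-1 *: (b - a) - y| < r ->
  `|b - a - t *: y| < r * t.
Proof.
move=> t0; rewrite -(ltr_pM2l t0) mulrC [t * r]mulrC => h; apply: le_lt_trans h.
rewrite mulrC -[X in X * _](gtr0_norm t0) -normrZ scalerBr scalerA mulfV ?gt_eqF//.
by rewrite scale1r.
Qed.

Let quot_norm (a b y : X) t r : 0 < t -> `|t^-1 *: (b - a) - y| < r ->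
  `|b - a| < t * `|y| + r * t.
Proof.
move=> t0 /(quot_normB t0) h; have := ler_normD (b - a - t *: y) (t *: y).
by rewrite subrK normrZ gtr0_norm//; lra.
Qed.

(* With w = y + lam z, a point G (u + t w) lies near G u + t (y, z) exactly when
   the increment of P at u along w is near t y; all four cones of M at G u are
   read off the error incr_err P u t w y in this way. *)
Lemma transfer : exists2 d, 0 < d & forall y z, exists2 tau, 0 < tau &
  forall u t eta, `|u - ubar| < d -> 0 < t -> t < tau -> 0 < eta ->
    (incr_err P u t (y + lam *: z) y < eta * t -> hits M t (G u) (y, z) (C1 * eta)) /\
    (eta <= 1 -> hits M t (G u) (y, z) eta -> incr_err P u t (y + lam *: z) y < C2 * eta * t).
Proof.
have [del del0 inM] := param_in; have [rho rho0 onto] := param_onto.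
have rho2 : 0 < rho / 2 by rewrite divr_gt0.
have [d d0 nd] := near_param rho2.
exists (Num.min (del / 2) d); first by rewrite lt_min d0 divr_gt0.
move=> y z; pose w := y + lam *: z.
have w1 : 0 < `|w| + 1 by rewrite ltr_pwDr.
have yz1 : 0 < `|y| + `|z| + 1 by rewrite ltr_pwDr// addr_ge0.
(* The first bound keeps u + t w where G takes values in M. The second, with eta <= 1, keeps a point
   p' found near G u + t (y, z) within rho / 2 of G u, hence within rho of G ubar, where
   [param_onto] applies. *)
exists (Num.min (del / 2 / (`|w| + 1)) (rho / 2 / (`|y| + `|z| + 1))).
  by rewrite lt_min !divr_gt0.
move=> u t eta; rewrite !lt_min => /andP[udel ud] t0 /andP[tdel trho] eta0.
rewrite ltr_pdivlMr// in tdel; rewrite ltr_pdivlMr// in trho.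
have ti : 0 < t^-1 by rewrite invr_gt0.
have li : 0 < lam^-1 by rewrite invr_gt0.
split=> [err|eta1 [p' Mp' [/= n1 n2]]].
  exists (G (u + t *: w)).
    apply: inM; rewrite addrAC (le_lt_trans (ler_normD _ _))// normrZ gtr0_norm//.
    have : 0 <= t by exact: ltW.
    by move: udel tdel; rewrite mulrDr mulr1; lra.
  have ny : `|t^-1 *: (P (u + t *: w) - P u) - y| < eta.
    have -> : t^-1 *: (P (u + t *: w) - P u) - y = t^-1 *: (P (u + t *: w) - P u - t *: y).
      by rewrite [in RHS]scalerBr scalerA mulVf ?gt_eqF// scale1r.
    by rewrite normrZ gtr0_norm// ltr_pdivrMl// mulrC.
  have el : 0 < lam^-1 * eta by rewrite mulr_gt0.
  split => /=; first by apply: (lt_trans ny); rewrite /C1 mulrDl mul1r ltrDl.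
  have -> : t^-1 *: (lam^-1 *: (u + t *: w - P (u + t *: w)) - lam^-1 *: (u - P u)) - z =
     lam^-1 *: (y - t^-1 *: (P (u + t *: w) - P u)).
    rewrite -scalerBr.
    have -> : u + t *: w - P (u + t *: w) - (u - P u) = t *: w - (P (u + t *: w) - P u).
      by rewrite [in RHS]opprB opprB [LHS]addrC -(addrA u) addrA subrK addrCA.
    rewrite scalerA mulrC -scalerA [t^-1 *: (_ - _)]scalerBr scalerA mulVf ?gt_eqF// scale1r.
    rewrite /w -addrA addrCA scalerDr scalerA mulVf ?gt_eqF// scale1r.
    by rewrite addrAC subrr add0r.
  rewrite normrZ gtr0_norm// distrC.
  by rewrite (lt_trans (_ : _ < lam^-1 * eta)) ?ltr_pM2l// /C1 mulrDl mul1r ltrDr.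
have eta_t : eta * t <= t by rewrite ler_piMl// ltW.
have [m1 m2] := nd u ud.
have p1 := quot_norm t0 n1; have p2 := quot_norm t0 n2.
have q1 := quot_normB t0 n1; have q2 := quot_normB t0 n2.
have ty0 : 0 <= t * `|y| by rewrite mulr_ge0// ltW.
have tz0 : 0 <= t * `|z| by rewrite mulr_ge0// ltW.
have p'E : P (p'.1 + lam *: p'.2) = p'.1.
  apply: onto => //; split.
    have := ler_normD (p'.1 - (G u).1) ((G u).1 - (G ubar).1); rewrite addrA subrK; lra.
  have := ler_normD (p'.2 - (G u).2) ((G u).2 - (G ubar).2); rewrite addrA subrK; lra.
have u'E : p'.1 + lam *: p'.2 - (u + t *: w) =
    (p'.1 - P u - t *: y) + lam *: (p'.2 - lam^-1 *: (u - P u) - t *: z).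
  rewrite !scalerBr !scalerA mulfV ?gt_eqF// !scale1r /w scalerDr scalerA (mulrC t).
  rewrite [RHS]addrACA -opprD [in LHS]opprD [LHS]addrA; congr (_ + _).
  by rewrite opprB [RHS]addrACA addKr.
have nu' : `|p'.1 + lam *: p'.2 - (u + t *: w)| <= (1 + lam) * (eta * t).
  rewrite u'E (le_trans (ler_normD _ _))// normrZ gtr0_norm// mulrDl mul1r lerD ?ltW//.
  by rewrite ltr_pM2l.
rewrite /incr_err.
have -> : P (u + t *: w) - P u - t *: y =
  (P (u + t *: w) - P (p'.1 + lam *: p'.2)) + (p'.1 - P u - t *: y).
  by rewrite p'E !addrA subrK.
have := ler_normD (P (u + t *: w) - P (p'.1 + lam *: p'.2)) (p'.1 - P u - t *: y).
have := P_lip (u + t *: w) (p'.1 + lam *: p'.2); rewrite [X in L * X]distrC.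
have : L * `|p'.1 + lam *: p'.2 - (u + t *: w)| <= L * ((1 + lam) * (eta * t)).
  by rewrite ler_wpM2l.
by rewrite /C2; lra.
Qed.

Let small eta : 0 < eta -> exists2 r, 0 < r & r <= 1 /\ C2 * r <= eta.
Proof.
move=> eta0; exists (Num.min 1 (eta / C2)); first by rewrite lt_min ltr01 divr_gt0.
by rewrite ge_min lexx; split => //; rewrite mulrC -ler_pdivlMr// ge_min lexx orbT.
Qed.

Let scale1 r : C1 * (r / C1) = r.
Proof. by rewrite mulrC divfK// gt_eqF. Qed.

Lemma tangent_derivable_param : exists2 d, 0 < d & forall u y z, `|u - ubar| < d ->
  (tangent_cone M (G u) (y, z) <-> tanP P u (y + lam *: z) y) /\
  (derivable_cone M (G u) (y, z) <-> derP P u (y + lam *: z) y).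
Proof.
have [d d0 T] := transfer; exists d => // u y z ud.
have [tau0 tau00 {}T] := T y z; split; split.
- move=> /tangent_coneP h eta tau eta0 tau_0.
  have [r r0 [r1 r2]] := small eta0.
  have [|t [t0 + m]] := h r (Num.min tau tau0) r0; first by rewrite lt_min tau_0.
  rewrite lt_min => /andP[t1 t2]; exists t; split => //.
  have [_ /(_ r1 m)] := T u t r ud t0 t2 r0.
  by move=> /lt_le_trans; apply; rewrite ler_wpM2r// ltW.
- move=> h; apply/tangent_coneP => r tau r0 tau_0.
  have [||t [t0 + m]] := h (r / C1) (Num.min tau tau0).
  + by rewrite divr_gt0.
  + by rewrite lt_min tau_0.
  rewrite lt_min => /andP[t1 t2]; exists t; split => //.
  have [|/(_ m)] := T u t (r / C1) ud t0 t2; first by rewrite divr_gt0.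
  by rewrite scale1.
- move=> /derivable_coneP h eta eta0; have [r r0 [r1 r2]] := small eta0.
  have [tau tau_0 {}h] := h r r0; exists (Num.min tau tau0); first by rewrite lt_min tau_0.
  move=> t t0; rewrite lt_min => /andP[t1 t2].
  have [_ /(_ r1 (h t t0 t1))] := T u t r ud t0 t2 r0.
  by move=> /lt_le_trans; apply; rewrite ler_wpM2r// ltW.
- move=> h; apply/derivable_coneP => r r0.
  have rC : 0 < r / C1 by rewrite divr_gt0.
  have [tau tau_0 {}h] := h _ rC; exists (Num.min tau tau0); first by rewrite lt_min tau_0.
  move=> t t0; rewrite lt_min => /andP[t1 t2].
  have [/(_ (h t t0 t1)) + _] := T u t (r / C1) ud t0 t2 rC.
  by rewrite scale1.
Qed.

Definition regP w y := forall eta, 0 < eta -> exists2 tau, 0 < tau &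
  forall u t, `|u - ubar| < tau -> 0 < t -> t < tau -> incr_err P u t w y < eta * t.
Definition parP w y := forall eta tau, 0 < eta -> 0 < tau -> exists u t,
  [/\ `|u - ubar| < tau, 0 < t, t < tau & incr_err P u t w y < eta * t].

Lemma regular_tangent_param y z :
  regular_tangent_cone M (G ubar) (y, z) <-> regP (y + lam *: z) y.
Proof.
have [d d0 /(_ y z)[tau0 tau00 T]] := transfer; split.
  move=> /regular_tangent_coneP h eta eta0; have [r r0 [r1 r2]] := small eta0.
  have [tau tau_0 {}h] := h r r0.
  have [del del0 inM] := param_in; have [d' d'0 nd] := near_param tau_0.
  exists (Num.min (Num.min d del) (Num.min d' (Num.min tau tau0))).
    by rewrite !lt_min d0 del0 d'0 tau_0.
  move=> u t; rewrite !lt_min => /andP[/andP[ud udel] /andP[ud' _]] t0.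
  move=> /and3P[_ _ /andP[ttau ttau0]].
  have m := h _ t (inM u udel) (nd u ud') t0 ttau.
  have [_ /(_ r1 m)] := T u t r ud t0 ttau0 r0.
  by move=> /lt_le_trans; apply; rewrite ler_wpM2r// ltW.
move=> h; apply/regular_tangent_coneP => r r0.
have rC : 0 < r / C1 by rewrite divr_gt0.
have [tau tau_0 {}h] := h _ rC.
have md : 0 < Num.min tau d by rewrite lt_min tau_0.
have [s s0 np] := near_is_param md.
exists (Num.min s (Num.min tau tau0)); first by rewrite !lt_min s0 tau_0.
move=> p t Mp pn t0; rewrite !lt_min => /and3P[_ ttau ttau0].
have [|u] := np p Mp; first by apply: pair_within_le pn; rewrite ge_min lexx.
rewrite lt_min => /andP[utau ud] ->.
have [/(_ (h u t utau t0 ttau)) + _] := T u t (r / C1) ud t0 ttau0 rC.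
by rewrite scale1.
Qed.

Lemma paratingent_param y z :
  paratingent_cone M (G ubar) (y, z) <-> parP (y + lam *: z) y.
Proof.
have [d d0 /(_ y z)[tau0 tau00 T]] := transfer; split.
  move=> /paratingent_coneP h eta tau eta0 tau_0; have [r r0 [r1 r2]] := small eta0.
  have md : 0 < Num.min tau d by rewrite lt_min tau_0.
  have [s s0 np] := near_is_param md.
  have [|p [t [Mp pn t0 + m]]] := h r (Num.min s (Num.min tau tau0)) r0.
    by rewrite !lt_min s0 tau_0.
  rewrite !lt_min => /and3P[_ ttau ttau0].
  have [|u] := np p Mp; first by apply: pair_within_le pn; rewrite ge_min lexx.
  rewrite lt_min => /andP[utau ud] pE; exists u, t; split => //.
  rewrite pE in m; have [_ /(_ r1 m)] := T u t r ud t0 ttau0 r0.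
  by move=> /lt_le_trans; apply; rewrite ler_wpM2r// ltW.
move=> h; apply/paratingent_coneP => r tau r0 tau_0.
have rC : 0 < r / C1 by rewrite divr_gt0.
have [del del0 inM] := param_in; have [d' d'0 nd] := near_param tau_0.
have [|u [t]] := h _ (Num.min (Num.min d del) (Num.min d' (Num.min tau tau0))) rC.
  by rewrite !lt_min d0 del0 d'0 tau_0.
rewrite !lt_min => -[/andP[/andP[ud udel] /andP[ud' _]] t0 /and3P[_ _ /andP[ttau ttau0]] m].
exists (G u), t; split => //; [exact: inM|exact: nd|].
have [/(_ m) + _] := T u t (r / C1) ud t0 ttau0 rC.
by rewrite scale1.
Qed.

(** Stated one direction at a time, since membership of (y, z) in a cone involves the single
    direction y + lam z. *)
Definition strict_diff := forall w, exists y, regP w y.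

Let zof w y := lam^-1 *: (w - y).
Let zofK w y : y + lam *: zof w y = w.
Proof. by rewrite /zof scalerA mulfV ?gt_eqF// scale1r addrC subrK. Qed.

Let cpt := finite_dimensional_compact inner_norm fin_dim.

Lemma regP_parP_unique w y y' : regP w y -> parP w y' -> y' = y.
Proof.
move=> h h'; apply/eqP; rewrite -subr_eq0 -normr_le0; apply/ler_addgt0Pr => eps eps0.
have e2 : 0 < eps / 2 by rewrite divr_gt0.
have [tau tau0 {}h] := h _ e2; have [u [t [ut t0 tt m]]] := h' _ _ e2 tau0.
have := incr_err_close P_lip t0 m (h u t ut t0 tt).
by rewrite subrr normr0; lra.
Qed.

Lemma tanP_parP w y : tanP P ubar w y -> parP w y.
Proof.
move=> h eta tau eta0 tau0; have [t [t0 tt m]] := h _ _ eta0 tau0.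
by exists ubar, t; split => //; rewrite subrr normr0.
Qed.

Lemma regP_derP w y : regP w y -> derP P ubar w y.
Proof.
move=> h eta eta0; have [tau tau0 {}h] := h _ eta0; exists tau => // t t0 tt.
by apply: h => //; rewrite subrr normr0.
Qed.

(** If the cones agree, a cluster value of the quotients at ubar, which exists by compactness, gives
    a paratingent vector and so a regular one. Conversely, where the quotients converge strictly, no
    other value can be paratingent. *)
Lemma strict_proto_strict_diff :
  regular_tangent_cone M (G ubar) = paratingent_cone M (G ubar) <-> strict_diff.
Proof.
split=> [E w|sd].
  have [y ty _] := tanP_exists P_lip cpt ubar w; exists y.
  have : paratingent_cone M (G ubar) (y, zof w y).
    by apply/paratingent_param; rewrite zofK; exact: tanP_parP.
  by rewrite -E => /regular_tangent_param; rewrite zofK.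
apply/seteqP; split=> -[y z].
  move=> /regular_tangent_param h; apply/paratingent_param.
  by apply: tanP_parP; apply: derP_tanP; exact: regP_derP.
move=> /paratingent_param h; apply/regular_tangent_param.
have [y' h'] := sd (y + lam *: z); have E := regP_parP_unique h' h.
by rewrite [X in regP _ X]E.
Qed.

(** Tangent vectors at nearby points have y close to the strict derivative along their own
    direction, which settles the outer limit. For the inner limit, [tanP_exists] supplies at each
    nearby point a tangent vector with exactly the prescribed w. *)
Lemma strict_diff_converges (D : set (X * X)) : D `<=` M ->
  (forall tau, 0 < tau -> exists2 p, D p & pair_within (G ubar) p tau) ->
  strict_diff ->
  pk_converges (within D (nbhs (G ubar))) (tangent_cone M) (tangent_cone M (G ubar)).
Proof.
move=> DM clD sd; apply/pk_converges_withinP => //.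
have [d d0 TD] := tangent_derivable_param.
have bar_d : `|ubar - ubar| < d by rewrite subrr normr0.
split=> -[y z] h.
  have [y' ry'] := sd (y + lam *: z).
  suff yy' : y = y'.
    apply/(TD ubar y z bar_d).1; rewrite [X in tanP _ _ _ X]yy'.
    exact/derP_tanP/regP_derP.
  apply/eqP; rewrite -subr_eq0 -normr_le0; apply/ler_addgt0Pr => eps eps0.
  (* Moving y and changing the direction cost C2 r = eps / 2 together; the two increment errors eps
     / 4 use up the rest. *)
  pose r := eps / 2 / (1 + L * (1 + lam)).
  have r0 : 0 < r by rewrite !divr_gt0.
  have e4 : 0 < eps / 4 by rewrite divr_gt0.
  have [tau tau0 {}ry'] := ry' _ e4.
  have md : 0 < Num.min tau d by rewrite lt_min tau0.
  have [s s0 np] := near_is_param md.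
  have [p [Dp pn [[y1 z1] ty1 y1n]]] := h r s r0 s0.
  have [u] := np p (DM _ Dp) pn; rewrite lt_min => /andP[utau ud] pE.
  rewrite pE in ty1; have [t [t0 tt m]] := (TD u y1 z1 ud).1.1 ty1 _ _ e4 tau0.
  have := incr_err_close P_lip t0 m (ry' u t utau t0 tt).
  have [/= n1 n2] := y1n.
  have : L * `|y1 + lam *: z1 - (y + lam *: z)| <= L * ((1 + lam) * r).
    by rewrite ler_wpM2l// ltW//; exact: (pair_within_sum y1n).
  have : r + L * ((1 + lam) * r) = eps / 2.
    by rewrite -[RHS](divfK (lt0r_neq0 C20)) -/r /C2; ring.
  have := ler_normD (y - y1) (y1 - y'); rewrite addrA subrK distrC in n1 *; lra.
move=> r r0; have [y' ry'] := sd (y + lam *: z).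
have yy' : y = y'.
  by apply: regP_parP_unique ry' _; apply: tanP_parP; apply/(TD ubar y z bar_d).1.
have rC : 0 < r / C1 by rewrite divr_gt0.
have rC2 : 0 < r / C1 / 2 by rewrite divr_gt0.
have [tau tau0 {}ry'] := ry' _ rC2.
have md : 0 < Num.min tau d by rewrite lt_min tau0.
have [s s0 np] := near_is_param md; exists s => // p Dp pn.
have [u] := np p (DM _ Dp) pn; rewrite lt_min => /andP[utau ud] ->.
have [y1 ty1 _] := tanP_exists P_lip cpt u (y + lam *: z).
exists (y1, zof (y + lam *: z) y1).
  by apply/(TD _ _ _ ud).1; rewrite zofK.
have [t [t0 tt m]] := ty1 _ _ rC2 tau0.
have y1y : `|y1 - y| < r / C1.
  have := incr_err_close P_lip t0 m (ry' u t utau t0 tt).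
  by rewrite -yy' subrr normr0; lra.
have li : 0 < lam^-1 by rewrite invr_gt0.
have h1 : r / C1 + lam^-1 * (r / C1) = r by rewrite -[RHS]scale1 /C1; ring.
have h2 : 0 < lam^-1 * (r / C1) by rewrite mulr_gt0.
split => /=; first by apply: lt_trans y1y _; rewrite -[ltRHS]h1 ltrDl.
have -> : zof (y + lam *: z) y1 - z = lam^-1 *: (y - y1).
  by rewrite /zof addrAC scalerDr scalerA mulVf ?gt_eqF// scale1r addrK.
rewrite normrZ gtr0_norm// distrC -[ltRHS]h1.
by apply: (@lt_trans _ _ (lam^-1 * (r / C1))); rewrite ?ltr_pM2l// ltrDr.
Qed.

Definition smooth_points := [set p | [/\ M p, derivable_cone M p = tangent_cone M p &
  linear_subspace (tangent_cone M p)]].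

(** With derivative A, both cones at G u are the kernel of the linear map sending (y, z) to y - A (y
    + lam z). *)
Lemma gateaux_smooth : exists2 d, 0 < d &
  forall u, `|u - ubar| < d -> gateaux P u -> smooth_points (G u).
Proof.
have [d d0 TD] := tangent_derivable_param; have [del del0 inM] := param_in.
exists (Num.min d del); first by rewrite lt_min d0.
move=> u; rewrite lt_min => /andP[ud udel] [A Alin AP].
have tanE y z : tangent_cone M (G u) (y, z) <-> y = A (y + lam *: z).
  split=> [/(TD _ _ _ ud).1 h|h].
    apply/eqP; rewrite -subr_eq0 -normr_le0 (le_trans (tanP_derP_close P_lip h (vecslope_derP (AP _))))//.
    by rewrite subrr normr0 mulr0.
  apply/(TD _ _ _ ud).1; rewrite [X in tanP _ _ _ X]h.
  exact/derP_tanP/vecslope_derP.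
have derE y z : derivable_cone M (G u) (y, z) <-> y = A (y + lam *: z).
  split=> [/(TD _ _ _ ud).2 h|h].
    by apply/tanE; apply/(TD _ _ _ ud).1; exact: derP_tanP.
  by apply/(TD _ _ _ ud).2; rewrite [X in derP _ _ _ X]h; exact: vecslope_derP.
split; first exact: inM.
  by apply/seteqP; split=> -[y z]; [move=> /derE/tanE|move=> /tanE/derE].
split.
  apply/tanE; rewrite scaler0 addr0.
  by have := Alin (-1) 0 0; rewrite scaler0 addr0 scaleN1r addNr.
move=> a [y z] [y' z'] /tanE h /tanE h'; apply/tanE.
by rewrite [LHS]/= {1}h {1}h' -Alin; congr A; rewrite /= !scalerDr !scalerA mulrC addrACA.
Qed.

Lemma gateaux_dense tau : 0 < tau -> exists2 u, `|u - ubar| < tau & gateaux P u.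
Proof.
move=> tau0; have [n [e [ee esp]]] := orthonormal_basis inner_norm fin_dim.
(* In direction 0 the line is the point u itself, so negligibility says that u is not
   exceptional. *)
have [u utau nu] := lnull_avoid 0 ubar (lnull_not_gateaux_vector inner_norm ee esp P_lip) tau0.
have [t /contrapT gu _] := ae_small ltr01 nu.
by exists u => //; rewrite scaler0 addr0 in gu.
Qed.

Lemma smooth_points_dense tau : 0 < tau ->
  exists2 p, smooth_points p & pair_within (G ubar) p tau.
Proof.
move=> tau0; have [d d0 sm] := gateaux_smooth; have [d' d'0 np] := near_param tau0.
have [|u] := gateaux_dense (_ : 0 < Num.min d d'); first by rewrite lt_min d0.
rewrite lt_min => /andP[ud ud'] gu.
by exists (G u); [exact: sm|exact: np].
Qed.

(* A cluster point y of derivatives of P in direction w gives a vector of the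
   limit cone, so the convergence forces all derivatives near ubar to be near y. *)
Lemma converges_strict_diff :
  pk_converges (within smooth_points (nbhs (G ubar))) (tangent_cone M)
    (tangent_cone M (G ubar)) -> strict_diff.
Proof.
move=> /(pk_converges_withinP _ _ smooth_points_dense)[h1 h2] w.
have [d d0 TD] := tangent_derivable_param; have [d1 d10 sm] := gateaux_smooth.
have [Y YP] := choice (fun u => let: ex_intro2 y t l := tanP_exists P_lip cpt u w in
  ex_intro _ y (conj t l)).
have FF : ProperFilter (within [set u | smooth_points (G u)] (nbhs ubar)).
  apply: within_nbhs_proper => U /nbhs_normP[r /= r0 rU].
  have [|u] := gateaux_dense (_ : 0 < Num.min r d1); first by rewrite lt_min r0.
  rewrite lt_min => /andP[ur ud1] gu; exists u; split; first exact: sm.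
  by apply: rU; rewrite /= distrC.
have [|y [_ ycl]] := @cpt 0 (L * `|w|) (Y @ within [set u | smooth_points (G u)] (nbhs ubar)) _.
  have YL u : `|Y u - 0| <= L * `|w| by rewrite subr0; have [] := YP u.
  exact: (filterS (fun u _ => YL u) filterT).
have {}ycl tau r : 0 < tau -> 0 < r -> exists u,
    [/\ `|u - ubar| < tau, smooth_points (G u) & `|Y u - y| < r].
  move=> tau0 r0.
  have [||_ [[u [utau su] <-] /=]] := ycl
      (Y @` [set u | `|u - ubar| < tau /\ smooth_points (G u)]) (ball y r).
  - apply/nbhs_normP; exists tau => // u /= utau su; exists u => //.
    by rewrite distrC.
  - exact: nbhsx_ballx.
  by rewrite -ball_normE/= distrC => Yu; exists u.
exists y => eta eta0.
have li : 0 < lam^-1 by rewrite invr_gt0.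
have Cy : tangent_cone M (G ubar) (y, zof w y).
  apply: h1 => r tau r0 tau0; have [d' d'0 np] := near_param tau0.
  have rC : 0 < r / C1 by rewrite divr_gt0.
  have [|u []] := ycl (Num.min d d') _ _ rC; first by rewrite lt_min d0.
  rewrite lt_min => /andP[ud ud'] su Yu.
  exists (G u); split => //; first exact: np.
  exists (Y u, zof w (Y u)).
    by apply/(TD _ _ _ ud).1; rewrite zofK; have [] := YP u.
  have e1 : r / C1 + lam^-1 * (r / C1) = r by rewrite -[RHS]scale1 /C1; ring.
  have e2 : 0 < lam^-1 * (r / C1) by rewrite mulr_gt0.
  split => /=; first by apply: lt_trans Yu _; rewrite -[ltRHS]e1 ltrDl.
  rewrite /zof -scalerBr normrZ gtr0_norm// opprB addrC addrA subrK distrC -[ltRHS]e1.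
  by apply: (@lt_trans _ _ (lam^-1 * (r / C1))); rewrite ?ltr_pM2l// ltrDr.
pose r := eta / 2 / C2.
have r0 : 0 < r by rewrite !divr_gt0.
have [s s0 {}h2] := h2 _ Cy r r0.
have [d2 d20 np] := near_param s0.
pose tau := Num.min d (Num.min d1 d2).
have tau0 : 0 < tau by rewrite !lt_min d0 d10.
have [n [e [ee esp]]] := orthonormal_basis inner_norm fin_dim.
have mv := @vecslope_mean_value _ _ _ inner_norm _ e ee esp P L ubar w y (eta / 2) tau
   _ L0 P_lip.
have w1 : 0 < `|w| + 1 by rewrite ltr_pwDr.
(* Both |u - ubar| and t |w| are then below tau / 2, so the segment stays where the derivatives are
   controlled. *)
exists (tau / 2 / (`|w| + 1)); first by rewrite !divr_gt0.
move=> u t ut t0 tt; rewrite ltr_pdivlMr// mulrDr mulr1 in tt; rewrite ltr_pdivlMr// mulrDr mulr1 in ut.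
have uw : 0 <= `|u - ubar| * `|w| by rewrite mulr_ge0.
apply: (@le_lt_trans _ _ (eta / 2 * t)); last by rewrite ltr_pM2r// ltr_pdivrMr// ltr_pMr// ltr1n.
apply: mv => //; [by rewrite divr_ge0// ltW| |lra].
move=> v; rewrite /tau !lt_min => /and3P[vd vd1 vd2] gv; have [A Alin AP] := gv.
exists (A w); first exact: AP.
have [[y1 z1] ty1 n1] := h2 _ (sm v vd1 gv) (np v vd2).
have := tanP_derP_close P_lip ((TD _ _ _ vd).1.1 ty1) (vecslope_derP (AP w)).
have := pair_within_sum n1; rewrite /= zofK => n2.
have : L * `|y1 + lam *: z1 - w| <= L * ((1 + lam) * r) by rewrite ler_wpM2l// ltW.
have : r + L * ((1 + lam) * r) = eta / 2.
  by rewrite -[RHS](divfK (lt0r_neq0 C20)) -/r /C2; ring.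
have [/= n3 _] := n1.
have := ler_normD (A w - y1) (y1 - y); rewrite addrA subrK [`|A w - y1|]distrC.
lra.
Qed.

End GraphCones.

(** * Prox-regularity and the proximal mapping *)

Section ProxRegular.
Variables (R : realType) (X : normedModType R) (inner : {dot X for idfun}).
Hypothesis inner_norm : forall x : X, `|x| ^+ 2 = inner x x.
Implicit Types (f : X -> \bar R) (x v u w : X).

(** The quadratic minorant makes (v, -1) a regular normal of the epigraph: for a tangent (w, b) it
    yields inner v w <= b up to c t |q|^2, which vanishes with t. Constant sequences then serve for
    the limiting cone. *)
Lemma proximal_subgradient f x v (c delta : R) : f x \is a fin_num -> 0 <= c -> 0 < delta ->
  (forall x', `|x' - x| <= delta ->
     (f x + (inner v (x' - x) - c * `|x' - x| ^+ 2)%:E <= f x')%E) ->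
  subdifferential inner f x v.
Proof.
move=> fx c0 delta0 prox; split => //.
exists (fun=> (x, fine (f x))), (fun=> (v, -1)); split; try exact: cvg_cst.
move=> _; split; first by rewrite /epi/= fineK.
move=> [w b] /tangent_coneP h; rewrite /epi_inner/= mulN1r.
apply/ler_addgt0Pr => eps eps0; rewrite add0r.
pose W := `|w| + 1; have W0 : 0 < W by rewrite ltr_pwDr.
(* r <= 1 bounds |q| by W, and the other bound makes r (|v| + 1) at most eps / 2. Below, tau keeps
   x' in the delta-ball and the quadratic term under eps / 2. *)
pose r := Num.min 1 (eps / 2 / (`|v| + 1)).
have v1 : 0 < `|v| + 1 by rewrite ltr_pwDr.
have r0 : 0 < r by rewrite lt_min ltr01 !divr_gt0.
have cW : 0 < c * W ^+ 2 + 1 by rewrite ltr_pwDr// mulr_ge0// exprn_ge0// ltW.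
pose tau := Num.min (delta / W) (eps / 2 / (c * W ^+ 2 + 1)).
have tau0 : 0 < tau by rewrite lt_min !divr_gt0.
have [t [t0 tt [[x' al] /= fx' [/= n1 n2]]]] := h r tau r0 tau0.
set q := t^-1 *: (x' - x) in n1.
have x'E : x' - x = t *: q by rewrite /q scalerA mulfV ?gt_eqF// scale1r.
have qW : `|q| <= W.
  have := ler_normD (q - w) w; rewrite subrK.
  have : r <= 1 by rewrite ge_min lexx.
  by rewrite /W; lra.
move: tt; rewrite lt_min => /andP[]; rewrite ltr_pdivlMr// => tW.
rewrite ltr_pdivlMr// mulrDr mulr1 => tc.
have x'd : `|x' - x| <= delta.
  rewrite x'E normrZ gtr0_norm//; apply: le_trans (ltW tW).
  by rewrite ler_wpM2l// ltW.
have := prox x' x'd; move: fx' n2; rewrite -(fineK fx) /=; set a := fine (f x) => fx' n2 pr.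
have := le_trans pr fx'; rewrite -EFinD lee_fin x'E innerZr normrZ gtr0_norm// exprMn => hal.
pose q2 := t^-1 * (al - a); have alE : al - a = t * q2.
  by rewrite /q2 mulrA mulfV ?mul1r ?gt_eqF.
have {hal} hq : inner v q - c * (t * `|q| ^+ 2) <= q2.
  rewrite -(ler_pM2l t0) -alE; move: hal; rewrite /= expr2; lra.
have nq2 : `|q2 - b| < r by exact: n2.
have qq : `|q| ^+ 2 <= W ^+ 2 by rewrite ler_pXn2r ?nnegrE// ltW.
have cq : c * (t * `|q| ^+ 2) <= eps / 2.
  apply: le_trans (_ : t * (c * W ^+ 2) <= _); last by have := ltW t0; lra.
  by rewrite mulrCA ler_wpM2l ?(ltW t0)// ler_wpM2l.
have vq : inner v w - inner v q <= `|v| * r.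
  rewrite -innerBr (le_trans (ler_norm _))// (le_trans (inner_cauchy inner_norm _ _))//.
  by rewrite ler_wpM2l// distrC ltW.
have vr : r * (`|v| + 1) <= eps / 2 by rewrite -ler_pdivlMr// ge_min lexx orbT.
move: nq2; rewrite ltr_norml => /andP[_ nq2].
by lra.
Qed.

(** It reads minimality of x for f + |. - u|^2 / (2 lam) as a proximal inequality for the vector (u
    - x) / lam. *)
Lemma quadratic_difference (lam : R) x x' u : 0 < lam ->
  (2 * lam)^-1 * `|x - u| ^+ 2 - (2 * lam)^-1 * `|x' - u| ^+ 2 =
  inner (lam^-1 *: (u - x)) (x' - x) - (2 * lam)^-1 * `|x' - x| ^+ 2.
Proof.
move=> l0.
have gen p q : (2 * lam)^-1 * `|q| ^+ 2 - (2 * lam)^-1 * `|p + q| ^+ 2 =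
    - (lam^-1 * inner q p) - (2 * lam)^-1 * `|p| ^+ 2.
  rewrite !inner_norm innerDl !innerDr (innerC inner p q).
  by field; rewrite gt_eqF.
have -> : x' - u = (x' - x) + (x - u) by rewrite addrA subrK.
by rewrite gen innerZl -mulrN -innerNl opprB.
Qed.

(** The direct method, with a limitation: local lower semicontinuity closes the sublevel sets of f
    only up to f xbar + eps0. A cluster point x of a minimizing sequence has to be tested at the
    level m - q x, and the small oscillation of q in [qeps] keeps this level admissible. *)
Lemma exists_minimizer f (q : X -> R) xbar (a B rho eps0 : R) : finite_dimensional X ->
  0 < rho -> rho <= eps0 -> f xbar = a%:E -> continuous q ->
  (forall alpha : R, (alpha%:E <= f xbar + eps0%:E)%E ->
    closed [set x | `|x - xbar| <= eps0 /\ (f x <= alpha%:E)%E]) ->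
  (forall x, `|x - xbar| <= rho -> q xbar - q x < eps0) ->
  (forall x, `|x - xbar| <= rho -> ((B - q x)%:E <= f x)%E) ->
  exists x b, [/\ `|x - xbar| <= rho, f x = b%:E, b + q x <= a + q xbar &
    forall x', `|x' - xbar| <= rho -> ((b + q x - q x')%:E <= f x')%E].
Proof.
move=> fd rho0 rho_eps fa cq clf qeps fB.
(* Real upper bounds s of f + q rather than its values, which may be infinite. *)
pose S := [set s : R | exists2 x, `|x - xbar| <= rho & (f x <= (s - q x)%:E)%E].
have Sa : S (a + q xbar).
  by exists xbar; [rewrite subrr normr0 ltW|rewrite addrK fa].
have lbS : has_lbound S.
  exists B => s [x xr fx]; have := le_trans (fB x xr) fx.
  by rewrite lee_fin; lra.
pose m := inf S.
have ma : m <= a + q xbar by exact: ge_inf.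
have /choice[xs xsP] : forall k : nat, exists x, `|x - xbar| <= rho /\
    (f x <= (m + k.+1%:R^-1 - q x)%:E)%E.
  move=> k; have k0 : 0 < k.+1%:R^-1 :> R by [].
  have [|s [x xr fx] sm] := inf_adherent k0 (_ : has_inf S).
    by split => //; exists (a + q xbar).
  exists x; split => //; apply: le_trans fx _; rewrite lee_fin.
  by rewrite lerD2r ltW.
have [|x [/= xrho xcl]] := @finite_dimensional_compact _ _ _ inner_norm fd xbar rho
    (xs @ \oo) (fmap_proper_filter _ _).
  by apply: (filterS (fun k _ => (xsP k).1) filterT).
have fxm (e : R) : 0 < e -> m - q x + e <= a + eps0 -> (f x <= (m - q x + e)%:E)%E.
  move=> e0 eb; set alpha := m - q x + e.
  have cl : closed [set x | `|x - xbar| <= eps0 /\ (f x <= alpha%:E)%E].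
    by apply: clf; rewrite fa -EFinD lee_fin.
  suff /cl [] : closure [set x | `|x - xbar| <= eps0 /\ (f x <= alpha%:E)%E] x by [].
  move=> U Ux; have e2 : 0 < e / 2 by rewrite divr_gt0.
  have Vx : nbhs x (U `&` [set y | q x - q y < e / 2]).
    apply: filterI => //.
    have /cvgrPdist_lt/(_ _ e2) := cq x.
    by apply: filterS => y; rewrite ltr_norml => /andP[].
  have [N Ne] := exists_natinv e2.
  have [|_ [[k Nk <-] [Uk /= qk]]] := xcl (xs @` [set k | (N <= k)%N]) _ _ Vx.
    by exists N => // k Nk; exists k.
  exists (xs k); split => //; have [k1 k2] := xsP k; split; first exact: le_trans rho_eps.
  apply: le_trans k2 _; rewrite lee_fin /alpha.
  have : k.+1%:R^-1 <= N.+1%:R^-1 :> R by rewrite lef_pV2 ?posrE// ler_nat.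
  move: Ne; move: (k.+1%:R^-1) (N.+1%:R^-1) => ik iN; lra.
have gap : 0 < a + eps0 - (m - q x) by have := qeps x xrho; lra.
have fx_le : (f x <= (m - q x)%:E)%E.
  apply/lee_addgt0Pr => e e0; rewrite -EFinD.
  (* Truncated so that the level m - q x + e' does not exceed a + eps0. *)
  pose e' := Num.min e (a + eps0 - (m - q x)).
  have e'0 : 0 < e' by rewrite lt_min e0.
  apply: le_trans (fxm e' e'0 _) _.
    have : e' <= a + eps0 - (m - q x) by rewrite /e' ge_min lexx orbT.
    lra.
  by rewrite lee_fin lerD2l /e' ge_min lexx.
have fin_x : f x \is a fin_num.
  rewrite fin_numElt (lt_le_trans _ (fB x xrho)) ?ltNyr//=.
  exact: le_lt_trans fx_le (ltry _).
have fxE : f x = (fine (f x))%:E by rewrite fineK.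
exists x, (fine (f x)); have bm : fine (f x) + q x <= m.
  by move: fx_le; rewrite fxE lee_fin; lra.
split => //; first exact: le_trans ma.
move=> x' x'r; case fx' : (f x') => [s| |].
- rewrite lee_fin; have : m <= s + q x' by apply: ge_inf => //; exists x' => //; rewrite fx' addrK.
  lra.
- by rewrite leey.
- by have := fB x' x'r; rewrite fx'.
Qed.

(** Comparing the minimizer x with xbar, the minorant and lam r <= 1/2 give |x - xbar|^2 / (4 lam)
    <= |h| |x - xbar| / lam, whence the factor 4. For |h| < rho / 8 the point x is thus within rho /
    2 of xbar, and minimality over the rho-ball holds on a full ball around x. *)
Lemma proximal_point f xbar vbar (a r eps lam : R) : finite_dimensional X ->
  f xbar = a%:E -> locally_lsc f xbar -> 0 < eps -> 0 <= r -> 0 < lam -> lam * r <= 1 / 2 ->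
  (forall x, `|x - xbar| <= eps ->
    ((a + (inner vbar (x - xbar) - r / 2 * `|x - xbar| ^+ 2))%:E <= f x)%E) ->
  exists2 d, 0 < d & forall u, `|u - (xbar + lam *: vbar)| < d -> exists x,
    `|x - xbar| <= 4 * `|u - (xbar + lam *: vbar)| /\
    subdifferential inner f x (lam^-1 *: (u - x)).
Proof.
move=> fd fa [eps0 eps00 clf] eps_0 r0 lam0 lamr low.
have li : 0 < lam^-1 by rewrite invr_gt0.
pose C := `|vbar| + lam^-1 + 1.
have C0 : 0 < C by rewrite ltr_pwDr// addr_ge0// ltW.
(* In turn: to simplify |h| |x - xbar| <= rho, for the minorant [low], for the closed sublevel sets,
   and for an oscillation of q below eps0. *)
pose rho := Num.min (Num.min 1 eps) (Num.min eps0 (eps0 / C / 2)).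
have rho0 : 0 < rho by rewrite !lt_min ltr01 eps_0 eps00 !divr_gt0.
have [rho1 rho_eps rho_eps0 rhoC] : [/\ rho <= 1, rho <= eps, rho <= eps0 & rho <= eps0 / C / 2].
  by rewrite /rho !ge_min !lexx !orbT.
exists (rho / 8); first by rewrite divr_gt0.
move=> u; set h := u - _ => hd.
pose q x := (2 * lam)^-1 * `|x - u| ^+ 2.
have cq : continuous q.
  move=> x; have cn : `|y - u| @[y --> x] --> `|x - u|.
    by apply: cvg_norm; apply: cvgB; [exact: cvg_id|exact: cvg_cst].
  exact: (cvgM (cvg_cst _) (cvgM cn cn)).
have uE : lam^-1 *: (u - xbar) = vbar + lam^-1 *: h.
  by rewrite /h opprD addrA [in RHS]scalerBr scalerA mulVf ?gt_eqF// scale1r [RHS]addrC subrK.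
have qd x : q xbar - q x = inner vbar (x - xbar) + lam^-1 * inner h (x - xbar)
    - (2 * lam)^-1 * `|x - xbar| ^+ 2.
  by rewrite /q quadratic_difference// uE innerDl innerZl.
have l2 : 0 < (2 * lam)^-1 by rewrite invr_gt0 mulr_gt0.
have cs1 x : inner vbar (x - xbar) <= `|vbar| * `|x - xbar|.
  exact: le_trans (ler_norm _) (inner_cauchy inner_norm _ _).
have cs2 x : inner h (x - xbar) <= `|h| * `|x - xbar|.
  exact: le_trans (ler_norm _) (inner_cauchy inner_norm _ _).
have hr : `|h| <= rho by rewrite (le_trans (ltW hd))// ler_pdivrMr// ler_peMr ?ltW// ltr1n.
have qeps x : `|x - xbar| <= rho -> q xbar - q x < eps0.
  move=> xr; rewrite qd.
  have b1 : inner vbar (x - xbar) <= `|vbar| * rho by rewrite (le_trans (cs1 x))// ler_wpM2l.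
  have b2 : lam^-1 * inner h (x - xbar) <= lam^-1 * rho.
    rewrite ler_pM2l// (le_trans (cs2 x))//.
    apply: le_trans (_ : 1 * rho <= _); last by rewrite mul1r.
    by apply: ler_pM => //; exact: le_trans rho1.
  have b3 : 0 <= (2 * lam)^-1 * `|x - xbar| ^+ 2 by rewrite mulr_ge0 ?exprn_ge0// ltW.
  move: rhoC; rewrite mulrAC ler_pdivlMr// /C; lra.
have lowq x : `|x - xbar| <= rho -> ((a + q xbar - (lam^-1 * `|h| * rho) - q x)%:E <= f x)%E.
  move=> xr; apply: le_trans (low x (le_trans xr rho_eps)); rewrite lee_fin.
  have := qd x.
  have b2 : lam^-1 * inner h (x - xbar) <= lam^-1 * `|h| * rho.
    by rewrite -mulrA ler_pM2l// (le_trans (cs2 x))// ler_wpM2l.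
  have b3 : r / 2 * `|x - xbar| ^+ 2 <= (2 * lam)^-1 * `|x - xbar| ^+ 2.
    rewrite ler_wpM2r ?exprn_ge0// -[leRHS]div1r ler_pdivlMr ?mulr_gt0//.
    by lra.
  lra.
have [x [b [xr fb bq xmin]]] := exists_minimizer fd rho0 rho_eps0 fa cq clf qeps lowq.
have x4 : `|x - xbar| <= 4 * `|h|.
  have := low x (le_trans xr rho_eps); rewrite fb lee_fin => lowx.
  have [x0|x0] := eqVneq `|x - xbar| 0; first by rewrite x0 mulr_ge0.
  have xp : 0 < `|x - xbar| by rewrite lt_neqAle eq_sym x0 normr_ge0.
  rewrite -(ler_pM2r xp) -expr2.
  have := qd x; have := cs2 x; rewrite -(ler_pM2l li) => h1 h2.
  have h3 : ((2 * lam)^-1 - r / 2) * `|x - xbar| ^+ 2 <= lam^-1 * (`|h| * `|x - xbar|) by lra.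
  have h4 : lam^-1 * (1 / 4) <= (2 * lam)^-1 - r / 2.
    rewrite invfM -[r](mulKf (lt0r_neq0 lam0)) -/(lam^-1).
    have : lam^-1 * (lam * r) <= lam^-1 * (1 / 2) by rewrite ler_pM2l.
    lra.
  have h5 : lam^-1 * (1 / 4) * `|x - xbar| ^+ 2 <= lam^-1 * (`|h| * `|x - xbar|).
    by apply: le_trans h3; rewrite ler_wpM2r// exprn_ge0.
  move: h5; rewrite -mulrA ler_pM2l//; lra.
exists x; split => //.
apply: (@proximal_subgradient _ _ _ (2 * lam)^-1 (rho / 2)); [by rewrite fb|exact: ltW| |].
  by rewrite divr_gt0.
move=> x' x'x; rewrite fb -EFinD -quadratic_difference//.
have := xmin x'; rewrite /q addrA; apply.
have := ler_normD (x' - x) (x - xbar); rewrite addrA subrK.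
lra.
Qed.

End ProxRegular.

(** * Localization of the graph of the subdifferential *)

Section Localization.
Variables (R : realType) (X : normedModType R) (inner : {dot X for idfun}).
Hypothesis inner_norm : forall x : X, `|x| ^+ 2 = inner x x.
Hypothesis fin_dim : finite_dimensional X.
Variables (f : X -> \bar R) (xbar vbar : X).
Hypothesis f_prox : prox_regular inner f xbar vbar.
Hypothesis f_subcont : subdifferentially_continuous inner f xbar vbar.
Implicit Types (x v u w : X) (p : X * X).
Local Notation df := (subdifferential inner f).

(** Counterexamples at scale 1 / (k + 1) would contradict subdifferential continuity. This
    discharges the condition on the values of f in prox-regularity, which then applies on a full
    neighbourhood in the graph. *)
Lemma subgradient_values_near (eps : R) : 0 < eps -> exists2 d, 0 < d &
  forall x v, df x v -> `|x - xbar| < d -> `|v - vbar| < d -> (f x < f xbar + eps%:E)%E.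
Proof.
move=> eps0; have [fx _ _ _] := f_prox; apply: contrapT => H.
have /choice[xv xvP] : forall k : nat, exists p : X * X,
    [/\ df p.1 p.2, `|p.1 - xbar| < k.+1%:R^-1, `|p.2 - vbar| < k.+1%:R^-1 &
      ~ (f p.1 < f xbar + eps%:E)%E].
  move=> k; apply: contrapT => Hk; apply: H; exists k.+1%:R^-1 => // x v xv xd vd.
  by apply: contrapT => nf; apply: Hk; exists (x, v).
have lim (g : X * X -> X) (z : X) : (forall k, `|g (xv k) - z| < k.+1%:R^-1) ->
    g (xv k) @[k --> \oo] --> z.
  move=> gz; apply/cvgrPdist_lt => e /exists_natinv[N Ne]; exists N => // k /= Nk.
  rewrite distrC (lt_trans (gz k))//; apply: le_lt_trans Ne.
  by rewrite lef_pV2 ?posrE// ler_nat.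
have cvgf : f (xv k).1 @[k --> \oo] --> f xbar.
  apply: (f_subcont (vs := fun k => (xv k).2)).
  - by move=> k; have [] := xvP k.
  - by apply: (lim fst) => k; have [] := xvP k.
  - by apply: (lim snd) => k; have [] := xvP k.
have : nbhs (f xbar) [set y | (y < f xbar + eps%:E)%E].
  rewrite -(fineK fx) -EFinD.
  exact: (nbhs_open_ereal_lt (f := fun r => r + eps) (ltr_pwDr eps0 (lexx _))).
move=> /cvgf[N _ /(_ N (leqnn N))] /= h.
by have [_ _ _] := xvP N.
Qed.

Lemma prox_regular_graph : exists (lam L : R) (P : X -> X),
  [/\ 0 < lam, 0 <= L, forall u v, `|P u - P v| <= L * `|u - v| &
    [/\ param P lam (xbar + lam *: vbar) = (xbar, vbar),
      exists2 del, 0 < del & forall u, `|u - (xbar + lam *: vbar)| < del ->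
        gph df (param P lam u) &
      exists2 rho, 0 < rho & forall p, gph df p ->
        pair_within (param P lam (xbar + lam *: vbar)) p rho ->
        P (p.1 + lam *: p.2) = p.1]].
Proof.
have [fx lsc df0 [eps [r [eps0 r0 pr]]]] := f_prox.
have [d1 d10 att] := subgradient_values_near eps0.
(* Makes lam r <= 1/2; r + 1 because r may be 0. *)
pose lam : R := (2 * (r + 1))^-1.
have r1 : 0 < r + 1 by rewrite ltr_pwDr.
have lam0 : 0 < lam by rewrite invr_gt0 mulr_gt0.
have lamr : lam * r <= 1 / 2.
  by rewrite /lam ler_pdivrMl ?mulr_gt0//; lra.
pose ubar := xbar + lam *: vbar.
have low x : `|x - xbar| <= eps ->
    ((fine (f xbar) + (inner vbar (x - xbar) - r / 2 * `|x - xbar| ^+ 2))%:E <= f x)%E.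
  rewrite EFinD fineK//; apply: pr => //.
    by rewrite !subrr normr0 expr0n addr0 sqrtr0 ltW.
  by rewrite -(fineK fx) -EFinD lte_fin ltrDl.
have [d2 d20 ex] := proximal_point inner_norm fin_dim (esym (fineK fx)) lsc eps0 r0 lam0 lamr low.
(* d1 controls the values of f, eps / 2 in each component puts (x, v) in the Euclidean eps-ball, and
   eps serves for x'. *)
pose c := Num.min (Num.min d1 (eps / 2)) eps.
have eps2 : 0 < eps / 2 by rewrite divr_gt0.
have c0 : 0 < c by rewrite !lt_min d10 divr_gt0//= eps0.
have prc x v x' : df x v -> `|x - xbar| < c -> `|v - vbar| < c -> `|x' - xbar| < c ->
    (f x + (inner v (x' - x) - r / 2 * `|x' - x| ^+ 2)%:E <= f x')%E.
  rewrite !lt_min => xv /andP[/andP[x1 x2] x3] /andP[/andP[v1 v2] v3] /andP[_ x'3].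
  apply: pr => //; last exact: ltW; last exact: att x1 v1.
  have sx : `|x - xbar| ^+ 2 <= (eps / 2) ^+ 2 by rewrite ler_pXn2r ?nnegrE ?(ltW x2)//; exact: ltW.
  have sv : `|v - vbar| ^+ 2 <= (eps / 2) ^+ 2 by rewrite ler_pXn2r ?nnegrE ?(ltW v2)//; exact: ltW.
  rewrite -[leRHS](ger0_norm (ltW eps0)) -sqrtr_sqr ler_wsqrtr//.
  have := sqr_ge0 eps; lra.
(* Adding the two prox-regularity inequalities bounds inner (v - v') (x - x') below by - r |x -
   x'|^2. With lam r <= 1/2 at least half of |x - x'|^2 survives in the product with the difference
   of the sums, hence the factor 2. *)
have mono x v x' v' : df x v -> df x' v' -> `|x - xbar| < c -> `|v - vbar| < c ->
    `|x' - xbar| < c -> `|v' - vbar| < c ->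
    `|x - x'| <= 2 * `|x + lam *: v - (x' + lam *: v')|.
  move=> xv xv' xc vc xc' vc'.
  have := prc _ _ _ xv xc vc xc'; have := prc _ _ _ xv' xc' vc' xc.
  have [fin_x _] := xv; have [fin_x' _] := xv'.
  rewrite -(fineK fin_x) -(fineK fin_x') -!EFinD !lee_fin [`|x' - x|]distrC => h1 h2.
  have h3 : inner (v - v') (x - x') >= - (r * `|x - x'| ^+ 2).
    by rewrite innerBl !innerBr; move: h1 h2; rewrite !innerBr; lra.
  have [x0|x0] := eqVneq `|x - x'| 0; first by rewrite x0 mulr_ge0.
  have xp : 0 < `|x - x'| by rewrite lt_neqAle eq_sym x0 normr_ge0.
  have cs := le_trans (ler_norm _) (inner_cauchy inner_norm (x + lam *: v - (x' + lam *: v')) (x - x')).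
  have E : inner (x + lam *: v - (x' + lam *: v')) (x - x') =
      `|x - x'| ^+ 2 + lam * inner (v - v') (x - x').
    by rewrite opprD addrACA -scalerBr [LHS]innerDl innerZl inner_norm.
  rewrite -(ler_pM2r xp) -expr2.
  have h4 : lam * inner (v - v') (x - x') >= lam * - (r * `|x - x'| ^+ 2) by rewrite ler_pM2l.
  have h5 : lam * r * `|x - x'| ^+ 2 <= 1 / 2 * `|x - x'| ^+ 2.
    by rewrite ler_wpM2r// exprn_ge0.
  move: cs; rewrite E; lra.
have li : 0 < lam^-1 by rewrite invr_gt0.
(* |x - xbar| is at most 4 |u - ubar|, and v - vbar is 1 / lam times (u - ubar) - (x - xbar), of
   norm at most 5 |u - ubar|. *)
pose d3 := Num.min d2 (Num.min (c / 4) (c / (5 * lam^-1))).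
have d30 : 0 < d3 by rewrite !lt_min d20 !divr_gt0// mulr_gt0.
have /choice[P0 P0P] : forall u, exists x, `|u - ubar| < d3 ->
    [/\ df x (lam^-1 *: (u - x)), `|x - xbar| <= 4 * `|u - ubar|,
      `|x - xbar| < c & `|lam^-1 *: (u - x) - vbar| < c].
  move=> u; have [ud|] := boolP (`|u - ubar| < d3); last by exists xbar.
  move: (ud); rewrite !lt_min => /and3P[ud2 udc ud5].
  have [x [xb xv]] := ex u ud2; exists x => _; split => //.
    by apply: le_lt_trans xb _; rewrite mulrC -ltr_pdivlMr.
  have -> : lam^-1 *: (u - x) - vbar = lam^-1 *: ((u - ubar) - (x - xbar)).
    have -> : u - ubar - (x - xbar) = u - x - lam *: vbar.
      by rewrite /ubar opprD addrA [LHS]addrAC; congr (_ - _); rewrite opprB addrA subrK.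
    by rewrite [RHS]scalerBr scalerA mulVf ?gt_eqF// scale1r.
  rewrite normrZ gtr0_norm//.
  have : lam^-1 * `|u - ubar - (x - xbar)| <= lam^-1 * (5 * `|u - ubar|).
    rewrite ler_pM2l//; have := ler_normB (u - ubar) (x - xbar); lra.
  move=> /le_lt_trans; apply; move: ud5; rewrite ltr_pdivlMr ?mulr_gt0//.
  by rewrite mulrA mulrC (mulrC 5).
have [n [e [ee esp]]] := orthonormal_basis inner_norm fin_dim.
have P0lip u v : `|u - ubar| < d3 -> `|v - ubar| < d3 -> `|P0 u - P0 v| <= 2 * `|u - v|.
  move=> /P0P[u1 u2 u3 u4] /P0P[v1 v2 v3 v4].
  have := mono _ _ _ _ u1 v1 u3 u4 v3 v4.
  by rewrite !scalerA mulfV ?gt_eqF// !scale1r ![_ + (_ - P0 _)]addrC !subrK.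
have [Q Qlip QP] := lipschitz_vector_extension inner_norm ee esp (ler0n _ 2)
  (B := [set u | `|u - ubar| < d3]) P0lip.
have ub : `|ubar - ubar| < d3 by rewrite subrr normr0.
have Qbar : Q ubar = xbar.
  rewrite QP//; have [_ + _ _] := P0P _ ub.
  by rewrite subrr normr0 mulr0 normr_le0 subr_eq0 => /eqP.
exists lam, (n%:R * 2), Q; split => //.
rewrite -/ubar; have Gbar : param Q lam ubar = (xbar, vbar).
  by rewrite /param Qbar /ubar addrAC subrr add0r scalerA mulVf ?gt_eqF// scale1r.
split => //.
  exists d3 => // u ud; rewrite /param QP//.
  by have [] := P0P _ ud.
rewrite Gbar; have l1 : 0 < 1 + lam by rewrite ltr_pwDl// ltW.
exists (Num.min c (d3 / (1 + lam))); first by rewrite lt_min c0 divr_gt0.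
move=> [x v] xv pn.
have ud : `|x + lam *: v - ubar| < d3.
  apply: lt_le_trans (pair_within_sum lam0 pn) _.
  by rewrite mulrC -ler_pdivlMr// ge_min lexx orbT.
(* (x, v) and the pair built from u = x + lam v have the same sum, so [mono] identifies them. *)
have [/= x1 v1] : pair_within (xbar, vbar) (x, v) c.
  by apply: pair_within_le pn; rewrite ge_min lexx.
rewrite /= QP//; have [u1 _ u3 u4] := P0P _ ud.
have := mono _ _ _ _ u1 xv u3 u4 x1 v1.
rewrite scalerA mulfV ?gt_eqF// scale1r.
have -> y : P0 y + (y - P0 y) = y by rewrite addrC subrK.
rewrite subrr normr0 mulr0.
by rewrite normr_le0 subr_eq0 => /eqP.
Qed.

End Localization.

(** * The cycle of implications, read in the coordinate u *)

Theorem corollary2p4 (R : realType) (X : normedModType R)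
    (inner : {dot X for idfun})
    (inner_norm : forall x : X, `|x| ^+ 2 = inner x x)
    (X_fin_dim : finite_dimensional X)
    (f : X -> \bar R) (xbar vbar : X)
    (f_prox : prox_regular inner f xbar vbar)
    (f_subcont : subdifferentially_continuous inner f xbar vbar) :
  let df := subdifferential inner f in
  let Ddf := fun p : X * X => graphical_derivative df p.1 p.2 in
  [<-> (* (a) *)
       strictly_proto_differentiable df xbar vbar;
       (* (b) *)
       graph_converges (within (gph df) (nbhs (xbar, vbar)))
         Ddf (Ddf (xbar, vbar));
       (* (c) *)
       graph_converges
         (within [set p | gph df p /\ proto_differentiable df p.1 p.2]
            (nbhs (xbar, vbar)))
         Ddf (Ddf (xbar, vbar));
       (* (d) *)
       graph_converges
         (within [set p | [/\ gph df p, proto_differentiable df p.1 p.2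
                            & linear_subspace (tangent_cone (gph df) p)]]
            (nbhs (xbar, vbar)))
         Ddf (Ddf (xbar, vbar))].
Proof.
move=> df Ddf; pose M := gph df.
have [lam [L [P [lam0 L0 P_lip [Gbar inM onto]]]]] :=
  prox_regular_graph inner_norm X_fin_dim f_prox f_subcont.
set ubar := xbar + lam *: vbar in Gbar inM onto.
have DdfE p : gph (Ddf p) = tangent_cone M p.
  by rewrite /Ddf/= /gph /graphical_derivative; apply/seteqP; split=> -[y z];
    rewrite /= -surjective_pairing.
have gcE D : graph_converges (within D (nbhs (xbar, vbar))) Ddf (Ddf (xbar, vbar)) =
    pk_converges (within D (nbhs (param P lam ubar))) (tangent_cone M)
      (tangent_cone M (param P lam ubar)).
  by rewrite /graph_converges Gbar DdfE (_ : (fun p => gph (Ddf p)) = tangent_cone M)//;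
    apply/funext.
have DsE : [set p | [/\ gph df p, proto_differentiable df p.1 p.2
    & linear_subspace (tangent_cone (gph df) p)]] = smooth_points M.
  by apply/seteqP; split=> -[x v].
have sd_a : strictly_proto_differentiable df xbar vbar <-> strict_diff P ubar.
  rewrite /strictly_proto_differentiable -Gbar.
  exact: (strict_proto_strict_diff inner_norm X_fin_dim L0 P_lip lam0 inM onto).
have dense := smooth_points_dense inner_norm X_fin_dim L0 P_lip lam0 inM onto.
have sd_conv D : smooth_points M `<=` D -> D `<=` M -> strict_diff P ubar ->
    pk_converges (within D (nbhs (param P lam ubar))) (tangent_cone M)
      (tangent_cone M (param P lam ubar)).
  move=> sD DM; apply: (strict_diff_converges inner_norm X_fin_dim L0 P_lip lam0 inM onto DM).
  by move=> tau /dense[p /sD]; exists p.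
(* A smaller domain shrinks the outer limit and enlarges the inner one, so convergence persists as
   long as D still accumulates at the base point. *)
have sub D D' : D `<=` D' -> (forall tau, 0 < tau -> exists2 p, D p & pair_within (param P lam ubar) p tau) ->
    pk_converges (within D' (nbhs (param P lam ubar))) (tangent_cone M)
      (tangent_cone M (param P lam ubar)) ->
    pk_converges (within D (nbhs (param P lam ubar))) (tangent_cone M)
      (tangent_cone M (param P lam ubar)).
  move=> DD' dD.
  have dD' tau : 0 < tau -> exists2 p, D' p & pair_within (param P lam ubar) p tau.
    by move=> /dD[p /DD']; exists p.
  move=> /(pk_converges_withinP _ _ dD')[h1 h2]; apply/(pk_converges_withinP _ _ dD); split.
    move=> q hq; apply: h1 => r tau r0 tau0.
    by have [p [/DD' ? ? ?]] := hq r tau r0 tau0; exists p.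
  move=> q Cq r r0; have [tau tau0 h] := h2 q Cq r r0.
  by exists tau => // p /DD'; exact: h.
rewrite !gcE DsE; tfae.
- by move=> /sd_a; apply: sd_conv => // p [].
- apply: sub; first by move=> p [].
  by move=> tau /dense[[x v] [? ? ?]]; exists (x, v).
- by apply: sub => // -[x v] [].
- move=> /(converges_strict_diff inner_norm X_fin_dim L0 P_lip lam0 inM onto).
  by move=> /sd_a.
Qed.
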